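(* Let $L$ and $N$ be torsion-free Lie algebras over $\mathbb{C}[\![t]\!]$ that are finitely generated as $\mathbb{C}[\![t]\!]$-modules. Then $R_{L\oplus N}^{\triangleleft}(T)=R_L^{\triangleleft}(T)R_N^{\triangleleft}(T)$. Suppose further that there is a $\mathbb{C}[\![t]\!]$-basis $\{x_1,\ldots,x_d\}$ of $L$ such that for every $j\in\{1,\ldots,d\}$ there exist integers $l_{j1},\ldots,l_{jd}$ with $l_{jj}\ne0$ such that, for all $z\in\mathbb{C}^*$, the linear map $x_r\mapsto z^{l_{jr}}x_r$ ($r=1,\ldots,d$) induces an automorphism of $L$. Then $R_{L\oplus N}^{\le}(T)=R_L^{\le}(T)R_N^{\le}(T)$.
   Context: Reduced zeta functions: let $\chi$ be the Euler characteristic on constructible sets over $\mathbb{C}$ (the unique integer-valued function with $\chi(\mathbb{C}^m)=1$, additive on disjoint constructible sets, and with $\chi(B)=e\chi(A)$ whenever $f:B\to A$ is a constructible map all of whose fibres have Euler characteristic $e$). For a Lie algebra $K$ over $\mathbb{C}[\![t]\!]$ finitely generated as a module and $n\ge0$, let $B_n^{\le}(K)$ (resp. $B_n^{\triangleleft}(K)$) be the constructible subset of the Grassmannian $\mathrm{Gr}(K/t^nK)$ consisting of the $\mathbb{C}[\![t]\!]$-submodules of $K$ of $\mathbb{C}$-codimension $n$ that are subalgebras (resp. ideals) of $K$. Then $R_K^*(T)=\sum_{n\ge0}\chi(B_n^*(K))T^n$ for $*\in\{\le,\triangleleft\}$ (equivalently, $\chi$ applied coefficientwise to the motivic zeta function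 $\sum_n[B_n^*(K)]T^n$ with values in the Grothendieck ring of varieties). *)

(* Defs.v *)
From mathcomp Require Import all_boot all_algebra.
From mathcomp Require Import reals.
From mathcomp.real_closed Require Import complex.
Set Implicit Arguments. Unset Strict Implicit. Unset Printing Implicit Defensive.
Import GRing.Theory.
Local Open Scope ring_scope.

Inductive pterm (F : fieldType) (m : nat) : Type :=
| PConst of F
| PVar of 'I_m
| PAdd of pterm F m & pterm F m
| PMul of pterm F m & pterm F m.

Fixpoint peval (F : fieldType) (m : nat) (p : pterm F m) (x : 'rV[F]_m) : F :=
  match p with
  | PConst c => c
  | PVar i => x 0 i
  | PAdd p q => peval p x + peval q x
  | PMul p q => peval p x * peval q x
  end.

Inductive constructible (F : fieldType) (m : nat) : ('rV[F]_m -> Prop) -> Prop :=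
| cons_zero (p : pterm F m) : constructible (fun x => peval p x = 0)
| cons_compl S : constructible S -> constructible (fun x => ~ S x)
| cons_union S T : constructible S -> constructible T ->
    constructible (fun x => S x \/ T x)
| cons_ext S T : constructible S -> (forall x, S x <-> T x) -> constructible T.

Definition constructible_map (F : fieldType) (m p : nat)
  (B : 'rV[F]_m -> Prop) (A : 'rV[F]_p -> Prop) (f : 'rV[F]_m -> 'rV[F]_p) :=
  (forall x, B x -> A (f x)) /\
  constructible (fun z : 'rV[F]_(m + p) => B (lsubmx z) /\ rsubmx z = f (lsubmx z)).

Definition is_euler_char (F : fieldType) (chi : forall m, ('rV[F]_m -> Prop) -> int) :=
  [/\ (forall m, chi m (fun _ => True) = 1),
      (forall m (A B : 'rV[F]_m -> Prop), constructible A -> constructible B ->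
         (forall x, A x -> B x -> False) ->
         chi m (fun x => A x \/ B x) = chi m A + chi m B) &
      (forall m p (B : 'rV[F]_m -> Prop) (A : 'rV[F]_p -> Prop) f (e : int),
         constructible B -> constructible A -> constructible_map B A f ->
         (forall a, A a -> chi m (fun x => B x /\ f x = a) = e) ->
         chi m B = e * chi p A)].

Definition pser (F : fieldType) := nat -> F.
Definition pmul (F : fieldType) (f g : pser F) : pser F :=
  fun e => \sum_(i < e.+1) f i * g (e - i)%N.

(** * Free Lie algebras of rank d over F[[t]] given by structure constants
    c i j k = coefficient of x_k in [x_i, x_j] w.r.t. the basis x_0..x_{d-1}. *)
Definition lie_sc (F : fieldType) (d : nat) := 'I_d -> 'I_d -> 'I_d -> pser F.

Definition is_lie (F : fieldType) (d : nat) (c : lie_sc F d) :=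
  [/\ (forall i k e, c i i k e = 0),
      (forall i j k e, c i j k e = - c j i k e) &
      (forall i j k l e,
         \sum_(m < d) (pmul (c i j m) (c m k l) e + pmul (c j k m) (c m i l) e
                       + pmul (c k i m) (c m j l) e) = 0)].

Definition lie_dsum (F : fieldType) (d1 d2 : nat) (c1 : lie_sc F d1)
  (c2 : lie_sc F d2) : lie_sc F (d1 + d2) :=
  fun i j k =>
    match split i, split j, split k with
    | inl a, inl b, inl c => c1 a b c
    | inr a, inr b, inr c => c2 a b c
    | _, _, _ => fun _ => 0
    end.

(** * The quotient K / t^n K, an element being the n x d matrix X with
    X a r = coefficient of t^a x_r *)
Definition qbracket (F : fieldType) (d n : nat) (c : lie_sc F d)
  (X Y : 'M[F]_(n, d)) : 'M[F]_(n, d) :=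
  \matrix_(a < n, k < d)
    \sum_(b < n) \sum_(b' < n) \sum_(i < d) \sum_(j < d)
      (if (b + b' <= a)%N then X b i * Y b' j * c i j k (a - b - b')%N else 0).

Definition qtmul (F : fieldType) (d n : nat) (X : 'M[F]_(n, d)) : 'M[F]_(n, d) :=
  \matrix_(a < n, r < d) \sum_(b < n | b.+1 == a) X b r.

(** * Subspaces of K/t^nK encoded by reduced row echelon matrices
    (the standard affine cell coordinates of the Grassmannian) *)
Definition is_rref (F : fieldType) (k N : nat) (A : 'M[F]_(k, N)) :=
  exists p : 'I_k -> 'I_N,
    [/\ (forall i j : 'I_k, (i < j)%N -> (p i < p j)%N),
        (forall i, A i (p i) = 1),
        (forall i (j : 'I_N), (j < p i)%N -> A i j = 0) &
        (forall i i', i' != i -> A i' (p i) = 0)].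

Definition qmem (F : fieldType) (d n k : nat) (A : 'M[F]_(k, n * d))
  (X : 'M[F]_(n, d)) := (mxvec X <= A)%MS.

(* submodules of K of codimension n (they contain t^n K), seen in K/t^nK *)
Definition Bsub_cond (F : fieldType) (d n : nat)
  (A : 'M[F]_(n * d - n, n * d)) :=
  [/\ (n <= n * d)%N, is_rref A &
      forall X, qmem A X -> qmem A (qtmul X)].

Definition B_le (F : fieldType) (d : nat) (c : lie_sc F d) (n : nat) :
  'rV[F]_((n * d - n) * (n * d)) -> Prop :=
  fun y => Bsub_cond (vec_mx y) /\
    (forall X Y, qmem (vec_mx y) X -> qmem (vec_mx y) Y ->
                 qmem (vec_mx y) (qbracket c X Y)).

Definition B_ideal (F : fieldType) (d : nat) (c : lie_sc F d) (n : nat) :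
  'rV[F]_((n * d - n) * (n * d)) -> Prop :=
  fun y => Bsub_cond (vec_mx y) /\
    (forall X Y, qmem (vec_mx y) X -> qmem (vec_mx y) (qbracket c Y X)).

Arguments B_le {F d} c n _.
Arguments B_ideal {F d} c n _.

(* for every z in F^*, x_r |-> z^(l r) x_r is an automorphism of L, i.e.
   (being F[[t]]-linear and invertible) preserves the bracket of basis elements *)
Definition diag_aut (F : fieldType) (d : nat) (c : lie_sc F d) (l : 'I_d -> int) :=
  forall z : F, z != 0 ->
    forall a b k e, z ^ (l a + l b) * c a b k e = z ^ (l k) * c a b k e.

(* Main.v *)
Require Import Defs.
From mathcomp Require Import all_boot all_algebra.
From mathcomp Require Import reals boolp closed_field zify ring.
From mathcomp.real_closed Require Import complex.
Set Implicit Arguments. Unset Strict Implicit. Unset Printing Implicit Defensive.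
Import GRing.Theory.
Local Open Scope ring_scope.

(* A torus scales the coordinates of L and fixes those of N: z acts by z on L
   for ideals (this commutes with all inner derivations), by the given
   automorphisms for subalgebras.  It permutes the submodules being counted, and
   in the echelon coordinates of a Schubert cell it acts diagonally, with nonzero
   weights (for a suitable torus) on the entries mixing an L-column with an
   N-column.  The locus where an entry x of nonzero weight does not vanish maps by x
   to the punctured line, with pairwise isomorphic fibres, so its Euler
   characteristic is a multiple of that of the punctured line, which is 0.  Hence
   only the submodules H that split as the sum of their intersections with L and
   N count, and these are pairs of submodules of L and N whose codimensions a and
   b add up to n.  As t is nilpotent on a
   quotient of dimension a, the L-part contains t^a L, so that it lives in
   L / t^a L.  All sets involved are first-order definable, hence constructible
   by quantifier elimination. *)

(** * Constructible sets and quantifier elimination *)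

Section Polynomial.
Variable F : fieldType.

(** Polynomiality is taken up to pointwise equality, so that matrix expressions are recognised by
    their shape instead of being written out as terms. *)
Definition polyf m (f : 'rV[F]_m -> F) := exists p, forall x, peval p x = f x.

Definition polymx m a b (A : 'rV[F]_m -> 'M[F]_(a, b)) :=
  forall i j, polyf (fun z => A z i j).

Lemma polyf_const m c : polyf (fun _ : 'rV[F]_m => c).
Proof. by exists (PConst m c). Qed.

Lemma polyf_add m (f g : 'rV[F]_m -> F) :
  polyf f -> polyf g -> polyf (fun z => f z + g z).
Proof. by move=> [p hp] [q hq]; exists (PAdd p q) => x /=; rewrite hp hq. Qed.

Lemma polyf_mul m (f g : 'rV[F]_m -> F) :
  polyf f -> polyf g -> polyf (fun z => f z * g z).
Proof. by move=> [p hp] [q hq]; exists (PMul p q) => x /=; rewrite hp hq. Qed.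

Lemma polyf_sum m (I : Type) (r : seq I) (P : pred I) (f : I -> 'rV[F]_m -> F) :
  (forall i, polyf (f i)) -> polyf (fun z => \sum_(i <- r | P i) f i z).
Proof.
move=> hf; elim: r => [|i r [p hp]].
  by exists (PConst m 0) => x /=; rewrite big_nil.
have [q hq] := hf i.
exists (if P i then PAdd q p else p) => x /=; rewrite big_cons.
by case: ifP => _ /=; rewrite hp ?hq.
Qed.

Lemma polyf_if m (b : bool) (f g : 'rV[F]_m -> F) :
  polyf f -> polyf g -> polyf (fun z => if b then f z else g z).
Proof. by case: b. Qed.

Lemma polymx_id m : polymx (fun z : 'rV[F]_m => z).
Proof. by move=> i j; exists (PVar F j) => x /=; rewrite (ord1 i). Qed.

Lemma polymx_const m a b (A : 'M[F]_(a, b)) : polymx (fun _ : 'rV[F]_m => A).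
Proof. by move=> i j; apply: polyf_const. Qed.

Lemma polymx_lsub m a b c (A : 'rV[F]_m -> 'M[F]_(a, b + c)) :
  polymx A -> polymx (fun z => lsubmx (A z)).
Proof.
move=> hA i j; have [p hp] := hA i (lshift c j).
by exists p => x; rewrite hp mxE.
Qed.

Lemma polymx_rsub m a b c (A : 'rV[F]_m -> 'M[F]_(a, b + c)) :
  polymx A -> polymx (fun z => rsubmx (A z)).
Proof.
move=> hA i j; have [p hp] := hA i (rshift b j).
by exists p => x; rewrite hp mxE.
Qed.

Lemma polymx_mxvec m a b (A : 'rV[F]_m -> 'M[F]_(a, b)) :
  polymx A -> polymx (fun z => mxvec (A z)).
Proof.
move=> hA i j; rewrite (ord1 i); case/mxvec_indexP: j => k l.
by have [p hp] := hA k l; exists p => x; rewrite hp mxvecE.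
Qed.

Lemma polymx_vec m a b (A : 'rV[F]_m -> 'rV[F]_(a * b)) :
  polymx A -> polymx (fun z => vec_mx (A z)).
Proof.
move=> hA i j; have [p hp] := hA 0 (mxvec_index i j).
by exists p => x; rewrite hp mxE.
Qed.

Lemma polymx_mul m a b c (A : 'rV[F]_m -> 'M[F]_(a, b))
    (B : 'rV[F]_m -> 'M[F]_(b, c)) :
  polymx A -> polymx B -> polymx (fun z => A z *m B z).
Proof.
move=> hA hB i j.
have [|p hp] := @polyf_sum m _ (index_enum 'I_b) xpredT (fun k z => A z i k * B z k j).
  by move=> k; apply: polyf_mul.
by exists p => x; rewrite hp mxE.
Qed.

Lemma polymx_qtmul m n d (X : 'rV[F]_m -> 'M[F]_(n, d)) :
  polymx X -> polymx (fun z => qtmul (X z)).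
Proof.
move=> hX i j.
have [|p hp] := @polyf_sum m _ (index_enum 'I_n) (fun b => b.+1 == i) (fun k z => X z k j).
  by move=> k.
by exists p => x; rewrite hp mxE.
Qed.

Lemma polymx_qbracket m n d (c : lie_sc F d) (X Y : 'rV[F]_m -> 'M[F]_(n, d)) :
  polymx X -> polymx Y -> polymx (fun z => qbracket c (X z) (Y z)).
Proof.
move=> hX hY a k.
suff [p hp] : polyf (fun z => \sum_(b < n) \sum_(b' < n) \sum_(i < d) \sum_(j < d)
      (if (b + b' <= a)%N then X z b i * Y z b' j * c i j k (a - b - b')%N else 0)).
  by exists p => x; rewrite hp mxE.
do 4 (apply: polyf_sum => ?).
apply: polyf_if; last exact: polyf_const.
by apply: polyf_mul; [apply: polyf_mul | apply: polyf_const].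
Qed.

Lemma polyf_comp m p (f : 'rV[F]_p -> F) (g : 'rV[F]_m -> 'rV[F]_p) :
  polyf f -> polymx g -> polyf (fun x => f (g x)).
Proof.
move=> [q hq] hg; suff [r hr] : polyf (fun x => peval q (g x)).
  by exists r => x; rewrite hr hq.
elim: q {hq} => [c|i|q IHq r IHr|q IHq r IHr] /=.
- exact: polyf_const.
- exact: hg.
- exact: polyf_add.
- exact: polyf_mul.
Qed.

Lemma polymx_comp m p a b (A : 'rV[F]_p -> 'M[F]_(a, b)) (g : 'rV[F]_m -> 'rV[F]_p) :
  polymx A -> polymx g -> polymx (fun x => A (g x)).
Proof. by move=> hA hg i j; exact: (polyf_comp (hA i j) hg). Qed.

End Polynomial.
Arguments polymx_id {F m}.

(** * Closure properties of constructible sets *)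

Section Constructible.
Variable F : fieldType.
Implicit Types m p : nat.

Lemma constructible_and m (S T : 'rV[F]_m -> Prop) :
  constructible S -> constructible T -> constructible (fun x => S x /\ T x).
Proof.
move=> hS hT.
apply: (cons_ext (cons_compl (cons_union (cons_compl hS) (cons_compl hT)))) => x.
split; last by move=> [? ?] [].
by move=> h; split; apply: contrapT => h'; apply: h; [left|right].
Qed.

Lemma constructible_imp m (S T : 'rV[F]_m -> Prop) :
  constructible S -> constructible T -> constructible (fun x => S x -> T x).
Proof.
move=> hS hT; apply: (cons_ext (cons_union (cons_compl hS) hT)) => x.
split; first by case.
by move=> h; have [/h|] := EM (S x) => ?; [right|left].
Qed.

Lemma constructible_iff m (S T : 'rV[F]_m -> Prop) :
  constructible S -> constructible T -> constructible (fun x => S x <-> T x).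
Proof. by move=> hS hT; apply: constructible_and; apply: constructible_imp. Qed.

Lemma constructible_const m (P : Prop) : constructible (fun _ : 'rV[F]_m => P).
Proof.
have [hP|hP] := EM P.
  by apply: (cons_ext (cons_zero (PConst m 0))) => x; split.
by apply: (cons_ext (cons_zero (PConst m 1))) => x /=; split => // /eqP; rewrite oner_eq0.
Qed.

Lemma constructible_exfin m (I : finType) (S : I -> 'rV[F]_m -> Prop) :
  (forall i, constructible (S i)) -> constructible (fun x => exists i, S i x).
Proof.
move=> hS.
suff h (r : seq I) : constructible (fun x => exists2 i, i \in r & S i x).
  apply: (cons_ext (h (enum I))) => x; split; first by case=> i _; exists i.
  by case=> i; exists i; rewrite ?mem_enum.
elim: r => [|i r IH].
  by apply: (cons_ext (constructible_const m False)) => x; split=> // -[].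
apply: (cons_ext (cons_union (hS i) IH)) => x; split.
  case=> [h|[j hj h]]; first by exists i => //; rewrite mem_head.
  by exists j => //; rewrite inE hj orbT.
case=> j; rewrite inE => /orP[/eqP->|hj h]; first by left.
by right; exists j.
Qed.

Lemma constructible_allfin m (I : finType) (S : I -> 'rV[F]_m -> Prop) :
  (forall i, constructible (S i)) -> constructible (fun x => forall i, S i x).
Proof.
move=> hS.
have h := cons_compl (constructible_exfin (fun i => cons_compl (hS i))).
apply: (cons_ext h) => x; split; last by move=> h1; case=> i; apply.
by move=> h1 i; apply: contrapT => h2; apply: h1; exists i.
Qed.

Lemma constructible_eq m (f g : 'rV[F]_m -> F) :
  polyf f -> polyf g -> constructible (fun x => f x = g x).
Proof.
move=> [p hp] [q hq].
apply: (cons_ext (cons_zero (PAdd p (PMul (PConst m (-1)) q)))) => x /=.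
rewrite hp hq mulN1r; split; first by move/eqP; rewrite subr_eq0 => /eqP.
by move=> ->; rewrite subrr.
Qed.

Lemma constructible_eqmx m a b (A B : 'rV[F]_m -> 'M[F]_(a, b)) :
  polymx A -> polymx B -> constructible (fun x => A x = B x).
Proof.
move=> hA hB.
have h := constructible_allfin (fun i => constructible_allfin (fun j =>
  constructible_eq (hA i j) (hB i j))).
by apply: (cons_ext h) => x; split=> [?|-> //]; apply/matrixP.
Qed.

(** Polynomials are substituted into the defining equations; this carries a condition on some of the
    coordinates over to a larger space. *)
Lemma constructible_preim m p (S : 'rV[F]_p -> Prop) (g : 'rV[F]_m -> 'rV[F]_p) :
  constructible S -> polymx g -> constructible (fun x => S (g x)).
Proof.
move=> hS hg; elim: hS => [q|T _|T U _ hT _ hU|T U _ hT e].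
- apply: constructible_eq; last exact: polyf_const.
  by apply: polyf_comp hg; exists q.
- exact: cons_compl.
- exact: cons_union.
- by apply: (cons_ext hT) => x.
Qed.

End Constructible.
Arguments constructible_const {F} m P.

(** * First-order definable sets over an algebraically closed field *)

Section QuantifierElimination.
Variable F : closedFieldType.

Let env m (x : 'rV[F]_m) : seq F := [seq x 0 i | i <- enum 'I_m].

Fact size_env m (x : 'rV[F]_m) : size (env x) = m.
Proof. by rewrite size_map size_enum_ord. Qed.

Fact nth_env m (x : 'rV[F]_m) (i : 'I_m) : (env x)`_i = x 0 i.
Proof. by rewrite (nth_map i) ?size_enum_ord ?nth_ord_enum. Qed.

Fact constructible_formula m (S : 'rV[F]_m -> Prop) : constructible S ->
  exists f : GRing.formula F, forall x, S x <-> GRing.holds (env x) f.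
Proof.
elim=> [q|T _ [f hf]|T U _ [f hf] _ [g hg]|T U _ [f hf] e].
- have [t ht] : exists t : GRing.term F, forall x, GRing.eval (env x) t = peval q x.
    elim: q => [c|i|q [f hf] r [g hg]|q [f hf] r [g hg]].
    + by exists (GRing.Const c).
    + by exists (GRing.Var F i) => x /=; rewrite nth_env.
    + by exists (GRing.Add f g) => x /=; rewrite hf hg.
    + by exists (GRing.Mul f g) => x /=; rewrite hf hg.
  by exists (GRing.Equal t (GRing.Const 0)) => x /=; rewrite ht.
- by exists (GRing.Not f) => x /=; rewrite hf.
- by exists (GRing.Or f g) => x /=; rewrite hf hg.
- by exists f => x; rewrite -e.
Qed.

Fact qf_constructible m (f : GRing.formula F) :
  GRing.qf_form f && GRing.rformula f ->
  constructible (fun x : 'rV[F]_m => GRing.holds (env x) f).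
Proof.
have ht (t : GRing.term F) : GRing.rterm t -> polyf (fun x : 'rV_m => GRing.eval (env x) t).
  elim: t => //=.
  - move=> i _; have [hi|hi] := ltnP i m.
      by exists (PVar F (Ordinal hi)) => x /=; rewrite -nth_env.
    (* A variable beyond the m coordinates reads the default value 0 of the list lookup. *)
    by exists (PConst m 0) => x /=; rewrite nth_default ?size_env.
  - by move=> c _; apply: polyf_const.
  - by move=> n _; apply: polyf_const.
  - by move=> t IHt u IHu /andP[/IHt ? /IHu ?]; apply: polyf_add.
  - move=> t IHt /IHt h; have [p hp] := polyf_mul (polyf_const m (-1)) h.
    by exists p => x; rewrite hp mulN1r.
  - move=> t IHt n /IHt h; have [p hp] := polyf_mul (polyf_const m (n%:R)) h.
    by exists p => x; rewrite hp mulr_natl.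
  - by move=> t IHt u IHu /andP[/IHt ? /IHu ?]; apply: polyf_mul.
  - move=> t IHt n /IHt h; elim: n => [|n IH]; first exact: polyf_const.
    by have [p hp] := polyf_mul h IH; exists p => x; rewrite hp exprS.
elim: f => //=.
- by move=> b _; apply: constructible_const.
- by move=> t u /andP[/ht ? /ht ?]; apply: constructible_eq.
- move=> f IHf g IHg /andP[/andP[qf qg] /andP[rf rg]].
  by apply: constructible_and; [apply: IHf; rewrite qf|apply: IHg; rewrite qg].
- move=> f IHf g IHg /andP[/andP[qf qg] /andP[rf rg]].
  by apply: cons_union; [apply: IHf; rewrite qf|apply: IHg; rewrite qg].
- move=> f IHf g IHg /andP[/andP[qf qg] /andP[rf rg]].
  by apply: constructible_imp; [apply: IHf; rewrite qf|apply: IHg; rewrite qg].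
- by move=> f IHf /IHf; apply: cons_compl.
Qed.

(** [to_rform] first removes inverses, since terms without them evaluate to polynomials; the
    quantifiers are then eliminated because [F] is algebraically closed. *)
Fact formula_constructible m (f : GRing.formula F) :
  constructible (fun x : 'rV[F]_m => GRing.holds (env x) f).
Proof.
have rf := GRing.to_rform_rformula f.
pose proj := @ClosedFieldQE.ex_elim F.
have wf : GRing.wf_QE_proj proj by apply: ClosedFieldQE.wf_ex_elim.
have vf : GRing.valid_QE_proj proj.
  exact: (ClosedFieldQE.holds_ex_elim (@GRing.solve_monicpoly F)).
have h := GRing.quantifier_elim_wf wf rf.
apply: (cons_ext (qf_constructible m h)) => x.
have [qf _] := andP h.
rewrite -(GRing.to_rformP _ f).
have P1 := GRing.qf_evalP (env x) qf.
have P2 := GRing.quantifier_elim_rformP wf vf (env x) rf.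
by split=> hx; [apply/P2; apply/P1|apply/P1; apply/P2].
Qed.

(** Chevalley's theorem on projections: the last p coordinates become bound variables, of index m to
    m + p - 1, in a formula describing the set. *)
Lemma constructible_exists m p (S : 'rV[F]_m -> 'rV[F]_p -> Prop) :
  constructible (fun z : 'rV_(m + p) => S (lsubmx z) (rsubmx z)) ->
  constructible (fun x => exists y, S x y).
Proof.
case/constructible_formula => f hf.
apply: (cons_ext (formula_constructible m (foldr GRing.Exists f (iota m p)))) => x.
rewrite -GRing.foldExistsP; split.
  case=> e he hef.
  exists (\row_(i < p) e`_(m + i)).
  set y := \row__ _; have := hf (row_mx x y); rewrite row_mxKl row_mxKr => ->.
  apply: GRing.eq_holds hef => i.
  have [hi|hi] := ltnP i (m + p); last first.
    have := he i; rewrite inE /= mem_iota negb_and -leqNgt -ltnNge hi orbT.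
    by move=> /(_ isT) <-; rewrite !nth_default ?size_env // (leq_trans _ hi) ?leq_addr.
  rewrite (nth_env _ (Ordinal hi)) mxE.
  case: splitP => j /= ->; last by rewrite mxE.
  by have := he j; rewrite inE /= mem_iota negb_and -ltnNge ltn_ord nth_env => <-.
case=> y; have := hf (row_mx x y); rewrite row_mxKl row_mxKr => -> h.
exists (env (row_mx x y)) => // i; rewrite inE /= mem_iota negb_and -leqNgt -ltnNge => hi.
have [him|him] := ltnP i m.
  rewrite (nth_env x (Ordinal him)) (nth_env (row_mx x y) (lshift p (Ordinal him))).
  by rewrite row_mxEl.
rewrite !nth_default ?size_env //.
by move: hi; rewrite leqNgt ltnS him.
Qed.

Lemma constructible_forall m p (S : 'rV[F]_m -> 'rV[F]_p -> Prop) :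
  constructible (fun z : 'rV_(m + p) => S (lsubmx z) (rsubmx z)) ->
  constructible (fun x => forall y, S x y).
Proof.
move=> /cons_compl cS.
apply: (cons_ext (cons_compl
  (@constructible_exists _ _ (fun x y => ~ S x y) cS))) => x.
split; last by move=> h []; move=> y; apply.
by move=> h y; apply: contrapT => h'; apply: h; exists y.
Qed.

Lemma constructible_forall_mx m a b (S : 'rV[F]_m -> 'M[F]_(a, b) -> Prop) :
  constructible (fun z : 'rV_(m + a * b) => S (lsubmx z) (vec_mx (rsubmx z))) ->
  constructible (fun x => forall X, S x X).
Proof.
move/(@constructible_forall _ _ (fun x y => S x (vec_mx y))) => cS.
by apply: (cons_ext cS) => x; split=> h X; [rewrite -[X]mxvecK|exact: h].
Qed.

Lemma constructible_qmem m n d k (A : 'rV[F]_m -> 'M[F]_(k, n * d))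
    (X : 'rV[F]_m -> 'M[F]_(n, d)) :
  polymx A -> polymx X -> constructible (fun z => qmem (A z) (X z)).
Proof.
move=> hA hX.
(* Membership in a row space asks for a vector of coefficients, so it is the projection of a
   polynomial condition. *)
apply: (@cons_ext _ _ (fun z => exists u, mxvec (X z) = u *m A z)); last first.
  by move=> z; split=> [[u e]|/submxP//]; apply/submxP; exists u.
apply: constructible_exists.
have pl := polymx_lsub (@polymx_id F (m + k)).
have hX' := polymx_mxvec (polymx_comp hX pl).
have hA' := polymx_mul (polymx_rsub (@polymx_id F (m + k))) (polymx_comp hA pl).
exact: (constructible_eqmx hX' hA').
Qed.

End QuantifierElimination.

(** * Euler characteristic and torus actions *)

Section EulerCharacteristic.
Variable F : closedFieldType.
Variable chi : forall m, ('rV[F]_m -> Prop) -> int.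
Hypothesis chiP : is_euler_char chi.

(** [chi] is a function of predicates; functional and propositional extensionality make it blind to
    the way a set is described. *)
Lemma chi_ext m (S T : 'rV[F]_m -> Prop) :
  (forall x, S x <-> T x) -> chi S = chi T.
Proof. by move=> e; congr chi; apply: funext => x; apply: propext. Qed.

(** The empty set is the disjoint union of two copies of itself, so its value is twice itself. *)
Lemma chi_False m : chi (fun _ : 'rV[F]_m => False) = 0.
Proof.
have [_ add _] := chiP.
have c := @constructible_const F m False.
apply: (@addrI _ (chi (fun _ : 'rV[F]_m => False))); rewrite addr0 -add //.
by apply: chi_ext => x; split=> // -[].
Qed.

Lemma chi_exfin (I : finType) m (S : I -> 'rV[F]_m -> Prop) :
  (forall i, constructible (S i)) -> (forall i j x, S i x -> S j x -> i = j) ->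
  chi (fun x => exists i, S i x) = \sum_i chi (S i).
Proof.
move=> cS dS; have [_ add _] := chiP.
suff h (r : seq I) : uniq r -> constructible (fun x => exists2 i, i \in r & S i x) /\
    chi (fun x => exists2 i, i \in r & S i x) = \sum_(i <- r) chi (S i).
  have [_ <-] := h (index_enum I) (index_enum_uniq I).
  apply: chi_ext => x; split; last by case=> i _; exists i.
  by case=> i; exists i; rewrite ?mem_index_enum.
elim: r => [|i r IH] /=.
  rewrite big_nil => _; split.
    by apply: (cons_ext (constructible_const _ False)) => x; split=> // -[].
  by rewrite -(chi_False m); apply: chi_ext => x; split=> // -[].
case/andP => ir /IH[cr er].
have e x : (S i x \/ (exists2 j, j \in r & S j x)) <-> (exists2 j, j \in i :: r & S j x).
  split=> [[?|[j jr ?]]|[j]].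
  - by exists i; rewrite ?mem_head.
  - by exists j; rewrite // inE jr orbT.
  - by rewrite inE => /orP[/eqP->|]; [left|right; exists j].
split; first exact: cons_ext (cons_union (cS i) cr) e.
rewrite big_cons -er -add // => [|x xi [j jr /(dS _ _ _ xi) ij]].
  by apply: chi_ext => x; rewrite e.
by rewrite ij jr in ir.
Qed.

(** The constant map from the affine space of dimension 0 has that whole space, of characteristic 1,
    as its only fibre. *)
Lemma chi_point m (a : 'rV[F]_m) : chi (fun x => x = a) = 1.
Proof.
have [one _ fib] := chiP.
have ca : constructible (fun x => x = a).
  by apply: constructible_eqmx; [apply: polymx_id | apply: polymx_const].
have := @fib 0%N m (fun _ => True) (fun x => x = a) (fun _ => a) 1.
rewrite one mul1r => <- //; first exact: constructible_const.
- split=> //; apply: (@cons_ext _ _ (fun z : 'rV_(0 + m) => rsubmx z = a)) => [|z]; last tauto.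
  by apply: constructible_eqmx; [apply/polymx_rsub/polymx_id | apply: polymx_const].
- by move=> b ->; rewrite -[RHS](one 0%N); apply: chi_ext => x.
Qed.

(** A constructible bijection has points as fibres. It is given by a relation [G] that has to be
    bijective only between [B] and [A], so that no formula for the map is required. *)
Lemma chi_bij m p (B : 'rV[F]_m -> Prop) (A : 'rV[F]_p -> Prop)
    (G : 'rV[F]_m -> 'rV[F]_p -> Prop) :
  constructible B -> constructible A ->
  constructible (fun z : 'rV_(m + p) => G (lsubmx z) (rsubmx z)) ->
  (forall x, B x -> exists2 y, A y & G x y) ->
  (forall y, A y -> exists2 x, B x & G x y) ->
  (forall x y y', B x -> A y -> A y' -> G x y -> G x y' -> y = y') ->
  (forall x x' y, B x -> B x' -> A y -> G x y -> G x' y -> x = x') ->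
  chi B = chi A.
Proof.
move=> cB cA cG tot sur fun_ inj; have [_ _ fib] := chiP.
(* The map is chosen inside [G], with default value 0 outside [B]; over [B] its graph is the
   restriction of [G] to [A], which is constructible. *)
have /choice[f hf] : forall x, exists y, B x -> A y /\ G x y.
  move=> x; have [/tot[y ? ?]|?] := EM (B x); first by exists y.
  by exists 0.
rewrite (@fib m p B A f 1) ?mul1r //.
- split=> [x /hf[]//|].
  have c : constructible (fun z : 'rV_(m + p) =>
      B (lsubmx z) /\ (A (rsubmx z) /\ G (lsubmx z) (rsubmx z))).
    apply: constructible_and; last apply: constructible_and => //.
      by apply: constructible_preim => //; apply/polymx_lsub/polymx_id.
    by apply: constructible_preim => //; apply/polymx_rsub/polymx_id.
  apply: (cons_ext c) => z; split=> [[bz [az gz]]|[bz ->]].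
    by split=> //; have [? ?] := hf _ bz; apply: (fun_ (lsubmx z)).
  by have [? ?] := hf _ bz.
- move=> a Aa; have [x Bx Gx] := sur a Aa.
  have [Afx Gfx] := hf x Bx.
  rewrite -(chi_point x); apply: chi_ext => x'; split=> [[Bx' e]|->].
    have [Afx' Gfx'] := hf x' Bx'; rewrite e in Afx' Gfx'.
    exact: (inj _ _ a).
  by split=> //; apply: (fun_ x).
Qed.

Lemma constructible_prod m p (A : 'rV[F]_m -> Prop) (B : 'rV[F]_p -> Prop) :
  constructible A -> constructible B ->
  constructible (fun z : 'rV_(m + p) => A (lsubmx z) /\ B (rsubmx z)).
Proof.
move=> cA cB; apply: constructible_and; apply: constructible_preim => //.
  exact/polymx_lsub/polymx_id.
exact/polymx_rsub/polymx_id.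
Qed.

(** The fibres of the second projection are copies of [A]. *)
Lemma chi_prod m p (A : 'rV[F]_m -> Prop) (B : 'rV[F]_p -> Prop) :
  constructible A -> constructible B ->
  chi (fun z : 'rV_(m + p) => A (lsubmx z) /\ B (rsubmx z)) = chi A * chi B.
Proof.
move=> cA cB; have [_ _ fib] := chiP.
have cAB := constructible_prod cA cB.
apply: (@fib _ _ _ _ (fun z => rsubmx z)) => //.
  split=> [z []//|]; apply: constructible_and.
    by apply: (constructible_preim cAB); apply/polymx_lsub/polymx_id.
  apply: constructible_eqmx; first exact/polymx_rsub/polymx_id.
  by apply/polymx_rsub/polymx_lsub/polymx_id.
move=> b Bb.
apply: (@chi_bij _ _ _ _ (fun z x => lsubmx z = x)) => //.
- apply: constructible_and => //.
  by apply: constructible_eqmx; [apply/polymx_rsub/polymx_id | apply: polymx_const].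
- apply: constructible_eqmx; last exact/polymx_rsub/polymx_id.
  exact/polymx_lsub/polymx_lsub/polymx_id.
- by move=> z [[? ?] ?]; exists (lsubmx z).
- by move=> x Ax; exists (row_mx x b); rewrite row_mxKl ?row_mxKr.
- by move=> x y y' _ _ _ <- <-.
- move=> x x' y [_ e] [_ e'] _ h h'.
  by rewrite -[x]hsubmxK -[x']hsubmxK e e' h h'.
Qed.

(** The line has characteristic 1, and so has the removed point. *)
Lemma chi_units : chi (fun x : 'rV[F]_1 => x 0 0 <> 0) = 0.
Proof.
have [one add _] := chiP.
have c0 : constructible (fun x : 'rV[F]_1 => x 0 0 = 0).
  by apply: constructible_eq; [apply: polymx_id | apply: polyf_const].
have := add _ _ _ c0 (cons_compl c0) (fun x e ne => ne e).
rewrite (@chi_ext _ _ (fun _ => True)) ?one; last by move=> x; split=> // _; apply: EM.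
rewrite (@chi_ext _ (fun x => x 0 0 = 0) (fun x => x = 0)) ?chi_point; last first.
  by move=> x; split=> [e|->]; [apply/rowP => j; rewrite ord1 e mxE | rewrite mxE].
by move=> e; apply: (@addrI _ 1); rewrite -e addr0.
Qed.

Definition torus_act m (w : 'I_m -> int) (z : F) (x : 'rV[F]_m) : 'rV[F]_m :=
  \row_i (z ^ w i * x 0 i).

Lemma polymx_torus_act m (w : 'I_m -> int) z p (X : 'rV[F]_p -> 'rV[F]_m) :
  polymx X -> polymx (fun x => torus_act w z (X x)).
Proof.
move=> hX i j; have [q hq] := polyf_mul (polyf_const p (z ^ w j)) (hX 0 j).
by exists q => x; rewrite hq mxE.
Qed.

Lemma torus_actK m (w : 'I_m -> int) z : z != 0 ->
  cancel (torus_act w z) (torus_act w z^-1).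
Proof.
move=> nz x; apply/rowP => i; rewrite !mxE mulrA -expfV mulVf ?mul1r //.
by rewrite expfz_neq0.
Qed.

Lemma exprz_surj (k : int) (c : F) : k != 0 -> c != 0 -> exists2 z : F, z != 0 & z ^ k = c.
Proof.
have pos (n : nat) (b : F) : n != 0%N -> b != 0 -> exists2 z : F, z != 0 & z ^+ n = b.
  case: n => // n _ nb.
  (* The equation is X^(n+1) = b: the only nonzero lower coefficient is the constant one. *)
  have [z hz] := @GRing.solve_monicpoly F n.+1 (fun i => if i == 0%N then b else 0) isT.
  have e : z ^+ n.+1 = b.
    rewrite hz big_ord_recl /= expr0 mulr1 big1 ?addr0 // => i _.
    by rewrite mul0r.
  exists z => //; apply: contraNneq nb => z0.
  by rewrite -e z0 expr0n.
move=> nk nc; case: k nk => n nk.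
  by apply: pos.
have [z nz ez] := pos n.+1 c^-1 isT (invr_neq0 nc).
by exists z => //; rewrite NegzE -exprnN ez invrK.
Qed.

(** The coordinate x_i maps the set to the punctured line. A z with z^(w i) = c exists by algebraic
    closedness and carries the fibre over 1 bijectively to the fibre over c, so all fibres have the
    same characteristic. *)
Lemma chi_torus_nonfixed m (w : 'I_m -> int) (B : 'rV[F]_m -> Prop) i :
  constructible B -> w i != 0 ->
  (forall z x, z != 0 -> B x -> B (torus_act w z x)) ->
  chi (fun x => B x /\ x 0 i <> 0) = 0.
Proof.
move=> cB wi inv; have [_ _ fib] := chiP.
pose f (x : 'rV[F]_m) : 'rV[F]_1 := const_mx (x 0 i).
have pf : polymx f by move=> a b; exists (PVar F i) => x; rewrite mxE.
have c0 p : constructible (fun x : 'rV[F]_p.+1 => x 0 0 <> 0).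
  by apply/cons_compl/constructible_eq; [apply: polymx_id | apply: polyf_const].
have cBi : constructible (fun x => B x /\ x 0 i <> 0).
  apply: constructible_and => //.
  by apply/cons_compl/constructible_eq; [apply: polymx_id | apply: polyf_const].
have cf c : constructible (fun x => (B x /\ x 0 i <> 0) /\ f x = c).
  by apply: constructible_and => //; apply: constructible_eqmx => //; apply: polymx_const.
rewrite (@fib _ _ _ (fun x : 'rV[F]_1 => x 0 0 <> 0) f
  (chi (fun x => (B x /\ x 0 i <> 0) /\ f x = const_mx 1))) //.
- by rewrite chi_units mulr0.
- split=> [x []|]; first by rewrite mxE.
  apply: constructible_and.
    by apply: (constructible_preim cBi); apply/polymx_lsub/polymx_id.
  apply: constructible_eqmx; first exact/polymx_rsub/polymx_id.
  move=> a b; have [p hp] := polymx_lsub (@polymx_id F (m + 1)) 0 i.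
  by exists p => x; rewrite hp [f _ _ _]mxE.
move=> c /eqP c00.
have [z nz ez] := exprz_surj wi c00.
have fE x (b : 'rV[F]_1) : f x = b <-> x 0 i = b 0 0.
  split=> [<-|e]; first by rewrite mxE.
  by apply/rowP => j; rewrite !ord1 mxE.
symmetry.
apply: (@chi_bij _ _ _ _ (fun x y => torus_act w z x = y)) => //.
- apply: constructible_eqmx; last exact/polymx_rsub/polymx_id.
  exact/polymx_torus_act/polymx_lsub/polymx_id.
- move=> x [[Bx _] /fE]; rewrite mxE => xi; exists (torus_act w z x) => //.
  have e : torus_act w z x 0 i = c 0 0 by rewrite mxE xi mulr1.
  by do 2?split; [apply: inv | rewrite e; apply/eqP | apply/fE].
- move=> y [[By _] /fE yi]; exists (torus_act w z^-1 y); last first.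
    by rewrite -{1}[z]invrK torus_actK ?invr_eq0.
  have e : torus_act w z^-1 y 0 i = 1 by rewrite mxE yi -expfV ez mulVf.
  split; last by apply/fE; rewrite e mxE.
  by split; [apply: inv; rewrite ?invr_eq0 | rewrite e; apply/eqP/oner_neq0].
- by move=> x y y' _ _ _ <- <-.
- by move=> x x' y _ _ _ h h'; apply: (can_inj (torus_actK w nz)); rewrite h h'.
Qed.

(* Coordinates of nonzero weight for some of the tori can be set to zero one
   after the other, since the tori commute with each other. *)
Lemma chi_torus_fixed m (J : Type) (w : J -> 'I_m -> int) (B : 'rV[F]_m -> Prop)
    (s : seq 'I_m) :
  constructible B ->
  (forall j z x, z != 0 -> B x -> B (torus_act (w j) z x)) ->
  (forall i, i \in s -> exists j, w j i != 0) ->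
  chi B = chi (fun x => B x /\ forall i, i \in s -> x 0 i = 0).
Proof.
move=> + + hs; elim: s hs B => [|i s IH] hs B cB inv.
  by apply: chi_ext => x; split=> // -[].
have [_ add _] := chiP.
have ci : constructible (fun x : 'rV[F]_m => x 0 i = 0).
  by apply: constructible_eq; [apply: polymx_id | apply: polyf_const].
have -> : chi B = chi (fun x => B x /\ x 0 i = 0).
  have [j wji] := hs i (mem_head i s).
  rewrite -[RHS]addr0 -(chi_torus_nonfixed cB wji (inv j)) -add.
  - by apply: chi_ext => x; have := EM (x 0 i = 0); tauto.
  - exact: constructible_and.
  - exact/constructible_and/cons_compl.
  - by move=> x; tauto.
rewrite (IH _ (fun x => B x /\ x 0 i = 0)).
- apply: chi_ext => x; split=> [[[Bx xi] xs]|[Bx xs]].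
    by split=> // k; rewrite inE => /orP[/eqP->|/xs].
  split=> [|k ks]; last by apply: xs; rewrite inE ks orbT.
  by split=> //; apply: xs; rewrite mem_head.
- by move=> k ks; apply: hs; rewrite inE ks orbT.
- exact: constructible_and.
- move=> j z x nz [Bx xi]; split; first exact: inv.
  by rewrite mxE xi mulr0.
Qed.

End EulerCharacteristic.

(** * Reduced echelon forms *)

Section EchelonForm.
Variable F : fieldType.
Implicit Types k N : nat.

(** Echelon form with its pivot columns recorded: the matrices with a given [p] form one Schubert
    cell. *)
Definition rref_at k N (A : 'M[F]_(k, N)) (p : 'I_k -> 'I_N) :=
  [/\ (forall i j : 'I_k, (i < j)%N -> (p i < p j)%N),
      (forall i, A i (p i) = 1),
      (forall i (j : 'I_N), (j < p i)%N -> A i j = 0) &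
      (forall i i', i' != i -> A i' (p i) = 0)].

Lemma rref_at_inj k N (A : 'M[F]_(k, N)) p q :
  rref_at A p -> rref_at A q -> p =1 q.
Proof.
move=> [_ p1 p0 _] [_ q1 q0 _] i; apply/val_inj/eqP; rewrite eqn_leq.
apply/andP; split; rewrite leqNgt; apply/negP => h.
  by have /eqP := q1 i; rewrite p0 // eq_sym oner_eq0.
by have /eqP := p1 i; rewrite q0 // eq_sym oner_eq0.
Qed.

Lemma rref_coef k N (A : 'M[F]_(k, N)) p (u : 'rV_k) i :
  rref_at A p -> (u *m A) 0 (p i) = u 0 i.
Proof.
move=> [_ p1 _ p0]; rewrite mxE (bigD1 i) //= p1 mulr1 big1 ?addr0 // => j ji.
by rewrite p0 ?mulr0.
Qed.

Lemma rref_comb k N (A : 'M[F]_(k, N)) p (v : 'rV_N) :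
  rref_at A p -> (v <= A)%MS -> v = (\row_i v 0 (p i)) *m A.
Proof.
move=> rA /submxP[u ->]; congr (_ *m A); apply/rowP => i.
by rewrite mxE rref_coef.
Qed.

Lemma rref_free k N (A : 'M[F]_(k, N)) : is_rref A -> row_free A.
Proof.
case=> p rA; apply/inj_row_free => u uA0; apply/rowP => i.
by rewrite -(rref_coef u i rA) uA0 !mxE.
Qed.

(** The coefficients of v are its entries at the pivots. One of them is nonzero at a pivot not after
    j, or else v would vanish at j; and this pivot is not before j, where v vanishes. *)
Lemma rref_lead k N (A : 'M[F]_(k, N)) p (v : 'rV_N) (j : 'I_N) :
  rref_at A p -> (v <= A)%MS -> v 0 j != 0 ->
  (forall l : 'I_N, (l < j)%N -> v 0 l = 0) -> exists i, j = p i.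
Proof.
move=> rA vA vj v0.
have [_ _ pz _] := rA.
have [i /andP[vi] le_ij] : exists i, (v 0 (p i) != 0) && (p i <= j)%N.
  apply/existsP; apply: contraR vj => /existsPn h.
  rewrite (rref_comb rA vA) mxE big1 // => i _; rewrite mxE.
  have := h i; rewrite negb_and negbK => /orP[/eqP->|]; first by rewrite mul0r.
  by rewrite -ltnNge => /pz ->; rewrite mulr0.
exists i; apply/val_inj/eqP; rewrite eqn_leq le_ij andbT leqNgt.
by apply: contra vi => /v0 ->.
Qed.

(** Every pivot of [A'] is a leading position in the row space of [A], hence a pivot of [A]. This
    writes [p'] as [p] after a strictly increasing self-map [s] of the row indices, and such an [s]
    satisfies i <= s i. *)
Lemma rref_pivot_le k N (A A' : 'M[F]_(k, N)) p p' :
  rref_at A p -> rref_at A' p' -> (A' <= A)%MS -> forall i, (p i <= p' i)%N.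
Proof.
move=> rA rA' sub.
have [pm _ _ _] := rA; have [pm' p1' p0' _] := rA'.
have lead i : exists i', p' i = p i'.
  apply: (rref_lead rA (v := row i A')).
  - exact: submx_trans (row_sub _ _) sub.
  - by rewrite mxE p1' oner_neq0.
  - by move=> l hl; rewrite mxE p0'.
have [s hs] := choice lead.
have pmono (i j : 'I_k) : (p i < p j)%N -> (i < j)%N.
  move=> h; rewrite ltnNge; apply/negP; rewrite leq_eqVlt => /orP[/eqP/val_inj e|/pm h'].
    by rewrite e ltnn in h.
  by have := ltn_trans h h'; rewrite ltnn.
have sm (i j : 'I_k) : (i < j)%N -> (s i < s j)%N.
  by move=> /pm'; rewrite !hs => /pmono.
have ge_s n : forall i : 'I_k, val i = n -> (n <= s i)%N.
  elim: n => // n IH i ei.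
  have hn : (n < k)%N by apply: ltnW; rewrite -ei ltn_ord.
  apply: leq_ltn_trans (IH (Ordinal hn) erefl) _.
  by apply: sm; rewrite /= ei.
move=> i; rewrite hs; have := ge_s _ i erefl.
by rewrite leq_eqVlt => /orP[/eqP/val_inj <- //|/pm/ltnW].
Qed.

(** The pivots agree by the inequality in both directions; a row of [A], read at the pivots of [A'],
    is then a unit vector of coefficients. *)
Lemma rref_uniq k N (A A' : 'M[F]_(k, N)) :
  is_rref A -> is_rref A' -> (A :=: A')%MS -> A = A'.
Proof.
case=> p rA [p' rA'] e.
have pp i : p' i = p i.
  apply/val_inj/eqP; rewrite eqn_leq.
  by rewrite (rref_pivot_le rA' rA) ?e // (rref_pivot_le rA rA') ?e.
have [_ p1 _ p0] := rA.
apply/row_matrixP => i.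
rewrite (rref_comb rA' (v := row i A)) -?e ?row_sub // [in RHS]rowE; congr (_ *m _).
apply/rowP => j; rewrite !mxE eqxx pp /=.
by case: eqVneq => [->|ij]; rewrite ?p1 // p0 // eq_sym.
Qed.

(** Gaussian elimination, by induction on the dimension: the first column [j0] on which [U] does not
    vanish gives the first pivot, and the vectors of [U] vanishing there form a subspace of
    dimension one less. *)
Lemma rref_exists N (U : {vspace 'rV[F]_N}) k : \dim U = k ->
  exists2 A : 'M[F]_(k, N), is_rref A & forall v, (v <= A)%MS = (v \in U).
Proof.
elim: k U => [|k IH] U dU.
  have p0 : 'I_0 -> 'I_N by case.
  exists (0 : 'M_(0, N)); first by exists p0; split=> -[].
  move=> v; have /eqP := dU; rewrite dimv_eq0 => /eqP ->.
  by rewrite memv0; apply/idP/eqP => [/submx0null|->]; rewrite ?sub0mx.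
pose P j := `[< exists2 v, v \in U & exists i : 'I_N, val i = j /\ v 0 i != 0 >].
have exP : exists j, P j.
  have U0 : U != 0%VS by rewrite -dimv_eq0 dU.
  have : vpick U != 0 by rewrite vpick0.
  case/rV0Pn => i hi; exists i; apply/asboolP; exists (vpick U); first exact: memv_pick.
  by exists i.
case: (ex_minnP exP) => _ /asboolP[v0 v0U [j0 [<- v0j0]]] minj.
have zU v (j : 'I_N) : v \in U -> (j < j0)%N -> v 0 j = 0.
  move=> vU; apply: contraTeq => vj; rewrite -leqNgt.
  by apply: minj; apply/asboolP; exists v => //; exists j.
pose f : 'Hom('rV[F]_N, 'M[F]_1) := linfun (mulmxr (delta_mx j0 0 : 'cV_N)).
have fE v : f v = (v 0 j0)%:M.
  by rewrite lfunE /=; apply/rowP => i; rewrite ord1 -colE !mxE eqxx mulr1n.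
have dW : \dim (U :&: lker f) = k.
  have := limg_ker_dim f U; rewrite dU.
  suff -> : \dim (f @: U) = 1%N by rewrite addn1 => -[].
  apply/eqP; rewrite eqn_leq; apply/andP; split.
    by apply: (leq_trans (dimvS (subvf _))); rewrite dimvf /dim /= ?mul1n.
  rewrite lt0n dimv_eq0; apply: contra v0j0 => /eqP e.
  have := memv_img f v0U; rewrite e memv0 fE => /eqP/rowP/(_ 0).
  by rewrite !mxE eqxx mulr1n => ->.
have memW v : (v \in (U :&: lker f)%VS) = (v \in U) && (v 0 j0 == 0).
  rewrite memv_cap memv_ker fE; congr (_ && _).
  apply/eqP/eqP => [/rowP/(_ 0)|->]; last by rewrite raddf0.
  by rewrite !mxE eqxx mulr1n.
have [A' [p' rA'] memA'] := IH _ dW.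
have [pm p1 pz po] := rA'.
have rowA' i : (row i A' \in U) && (A' i j0 == 0).
  have := row_sub i A'; rewrite memA' memW => /andP[-> /=].
  by rewrite mxE.
pose v1 : 'rV[F]_N := (v0 0 j0)^-1 *: v0.
(* This clears the pivot columns of [A'] from [v1]; the entry 1 in column [j0] survives because [A']
   vanishes there. *)
pose v2 : 'rV[F]_N := v1 - (\row_i v1 0 (p' i)) *m A'.
have v2U : v2 \in U.
  rewrite rpredB ?rpredZ // mulmx_sum_row rpred_sum // => i _.
  by rewrite rpredZ //; case/andP: (rowA' i).
have v2j0 : v2 0 j0 = 1.
  rewrite !mxE mulVf // big1 ?subr0 // => i _.
  by case/andP: (rowA' i) => _ /eqP ->; rewrite mulr0.
have v2p i : v2 0 (p' i) = 0.
  by rewrite /v2 [LHS]mxE [X in _ + X]mxE (rref_coef _ _ rA') [X in _ - X]mxE subrr.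
have ltp i : (j0 < p' i)%N.
  rewrite ltn_neqAle; case/andP: (rowA' i) => rU /eqP aj0; apply/andP; split.
    by apply/eqP => /val_inj e; have /eqP := p1 i; rewrite -e aj0 eq_sym oner_eq0.
  rewrite leqNgt; apply/negP => /(zU _ _ rU); rewrite mxE p1 => /eqP.
  by rewrite oner_eq0.
pose p (i : 'I_(1 + k)) := match split i with inl _ => j0 | inr i' => p' i' end.
exists (col_mx v2 A').
  exists p; split.
  - move=> i j; rewrite /p; case: splitP => i' ei; case: splitP => j' ej; rewrite ei ej.
    + by rewrite (ord1 i') (ord1 j') ltnn.
    + by rewrite ltp.
    + by rewrite (ord1 j').
    + by rewrite ltn_add2l => /pm.
  - by move=> i; rewrite mxE /p; case: split => i' //; rewrite (ord1 i').
  - move=> i j; rewrite mxE /p; case: split => i'; last exact: pz.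
    by rewrite (ord1 i') => /(zU _ _ v2U).
  - move=> i i'; rewrite mxE /p; case: splitP => a ea; case: splitP => b eb ne.
    + by case/eqP: ne; apply/val_inj; rewrite /= ea eb (ord1 a) (ord1 b).
    + by rewrite (ord1 a) v2p.
    + by case/andP: (rowA' a) => _ /eqP.
    + apply: po; apply: contra ne => /eqP e.
      by apply/eqP/val_inj; rewrite /= ea eb e.
move=> v; apply/idP/idP.
  case/submxP => u ->.
  have -> : u *m col_mx v2 A' =
      lsubmx (u : 'rV_(1 + k)) *m v2 + rsubmx (u : 'rV_(1 + k)) *m A'.
    by rewrite -mul_row_col hsubmxK.
  apply: rpredD.
    by rewrite mulmx_sum_row rpred_sum // => i _; rewrite rpredZ // (ord1 i) row_id.
  rewrite mulmx_sum_row rpred_sum // => i _; rewrite rpredZ //.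
  by case/andP: (rowA' i).
move=> vU; have : v - v 0 j0 *: v2 \in (U :&: lker f)%VS.
  rewrite memW rpredB ?rpredZ //=.
  by rewrite mxE [X in _ + X]mxE [X in _ - X]mxE v2j0 mulr1 subrr.
rewrite -memA' => h; suff: (v <= v2 + A')%MS by rewrite addsmxE.
rewrite -[v](subrK (v 0 j0 *: v2)).
apply: addmx_sub; first exact: submx_trans h (addsmxSr _ _).
by apply: scalemx_sub; apply: addsmxSl.
Qed.

Variables n d k : nat.

Lemma qmem_vspace (A : 'M[F]_(k, n * d)) : row_free A ->
  exists2 U : {vspace 'M[F]_(n, d)}, \dim U = k & forall X, qmem A X <-> X \in U.
Proof.
move=> fA; pose f : 'Hom('rV[F]_k, 'M[F]_(n, d)) := linfun (vec_mx \o mulmxr A).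
exists (limg f).
  rewrite limg_dim_eq ?dimvf /dim /= ?mul1n //.
  apply/eqP; rewrite -subv0; apply/subvP => u; rewrite memv_cap memvf /= memv_ker lfunE /=.
  rewrite memv0 => /eqP/(congr1 mxvec); rewrite vec_mxK linear0 => e.
  by apply/eqP/(row_free_inj fA); rewrite mul0mx.
move=> X; rewrite /qmem; split.
  case/submxP => u e; rewrite -[X]mxvecK e.
  by have := memv_img f (memvf u); rewrite lfunE.
by case/memv_imgP => u _ ->; rewrite lfunE /= vec_mxK submxMl.
Qed.

Lemma vspace_rref (U : {vspace 'M[F]_(n, d)}) : \dim U = k ->
  exists2 A : 'M[F]_(k, n * d), is_rref A & forall X, qmem A X <-> X \in U.
Proof.
move=> dU; pose f : 'Hom('M[F]_(n, d), 'rV[F]_(n * d)) := linfun mxvec.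
have k0 : lker f == 0%VS.
  by apply/lker0P => X Y; rewrite !lfunE; apply: (can_inj mxvecK).
have [|A rA hA] := @rref_exists _ (f @: U) k.
  by rewrite limg_dim_eq // (eqP k0) capv0.
exists A => // X; rewrite /qmem hA; split; last first.
  by move=> XU; have := memv_img f XU; rewrite lfunE.
case/memv_imgP => Y YU; rewrite lfunE => /(can_inj mxvecK) -> //.
Qed.

(** A subspace has only one echelon matrix, so points of the parameter space and submodules are the
    same data. *)
Lemma qmem_rref_inj (A A' : 'M[F]_(k, n * d)) :
  is_rref A -> is_rref A' -> (forall X : 'M_(n, d), qmem A X <-> qmem A' X) -> A = A'.
Proof.
move=> rA rA' e; apply: rref_uniq => //; apply/eqmxP/andP.
split; apply/rV_subP => v hv; have := e (vec_mx v); rewrite /qmem vec_mxK; tauto.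
Qed.

End EchelonForm.

(** * Multiplication by t and truncation *)

Section TMultiplication.
Variable F : fieldType.
Variables n d : nat.
Implicit Types X Y : 'M[F]_(n, d).

Lemma qtmulE X : qtmul X = (\matrix_(i < n, j < n) (j.+1 == i)%:R) *m X.
Proof.
apply/matrixP => i r; rewrite !mxE big_mkcond; apply: eq_bigr => b _.
by rewrite mxE; case: ifP => _; rewrite ?mul1r ?mul0r.
Qed.

Lemma iter_qtmul_ge m X (i j : 'I_n) r : i = (j + m)%N :> nat ->
  iter m (@qtmul F d n) X i r = X j r.
Proof.
elim: m i j => [|m IH] i j e /=.
  by rewrite addn0 in e; rewrite (val_inj e).
have hjm : (j + m < n)%N by rewrite ltnW // -addnS -e.
rewrite mxE (big_pred1 (Ordinal hjm)) ?(IH _ j) // => b /=.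
by rewrite e addnS eqSS -val_eqE.
Qed.

Lemma iter_qtmul_lt m X (i : 'I_n) r : (i < m)%N ->
  iter m (@qtmul F d n) X i r = 0.
Proof.
elim: m i => // m IH i im /=; rewrite mxE big1 // => b /eqP e.
by apply: IH; rewrite -ltnS (leq_trans _ im) // e.
Qed.

Lemma iter_qtmul_nilp X : iter n (@qtmul F d n) X = 0.
Proof. by apply/matrixP => i r; rewrite iter_qtmul_lt ?mxE. Qed.

(** The preimages of [U] under the powers t^i increase, and they reach the whole space because t is
    nilpotent. Until then each step raises the dimension by at least 1, so a steps suffice. *)
Lemma iter_qtmul_codim (U : {vspace 'M[F]_(n, d)}) a :
  (forall X, X \in U -> qtmul X \in U) -> (\dim U + a = n * d)%N ->
  forall X, iter a (@qtmul F d n) X \in U.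
Proof.
move=> tU da.
pose T : 'Hom('M[F]_(n, d), 'M[F]_(n, d)) :=
  linfun (mulmx (\matrix_(i < n, j < n) (j.+1 == i)%:R)).
have TE X : T X = qtmul X by rewrite lfunE qtmulE.
pose V i := iter i (fun W => T @^-1: W)%VS U.
have memV i X : (X \in V i) = (iter i (@qtmul F d n) X \in U).
  elim: i X => //= i IH X; rewrite -memv_preim IH TE; congr (_ \in U).
  by rewrite -iterSr.
have V_n : V n = fullv.
  by apply/eqP; rewrite eqEsubv subvf /=; apply/subvP => X _; rewrite memV iter_qtmul_nilp mem0v.
have V_S i : (V i <= V i.+1)%VS.
  by apply/subvP => X; rewrite !memV => /tU.
have V_full i : (\dim U + i <= \dim (V i))%N \/ V i = fullv.
  elim: i => [|i [IH|IH]]; first by rewrite addn0; left.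
    have [e|ne] := eqVneq (V i) (V i.+1).
      right; rewrite -e -V_n.
      (* A chain that stalls once is constant from there on, so it already equals [V n], the full
         space. *)
      suff h j : V (i + j)%N = V i.
        have -> : V n = V (i + n)%N.
          apply/vspaceP => X; rewrite V_n memvf memV iterD iter_qtmul_nilp.
          by rewrite -memV mem0v.
        by rewrite h.
      elim: j => [|j IHj]; first by rewrite addn0.
      by rewrite addnS [LHS]/= -/(V (i + j)%N) IHj [RHS]e.
    left; rewrite addnS; apply: leq_ltn_trans IH _.
    rewrite ltn_neqAle dimvS ?V_S // andbT.
    by apply: contra ne => /eqP e; rewrite eqEdim V_S e leqnn.
  right; apply/eqP; rewrite eqEsubv subvf /=.
  by rewrite -IH V_S.
have Va : V a = fullv.
  have [h|//] := V_full a; apply/eqP.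
  by rewrite eqEdim subvf /= dimvf /dim /= -da.
by move=> X; rewrite -memV Va memvf.
Qed.

End TMultiplication.

(** * Reduction modulo a smaller power of t *)

Section Truncation.
Variable F : fieldType.
Variables (a n d : nat) (le_an : (a <= n)%N).
Implicit Types X Y : 'M[F]_(n, d).

(** The a by n partial identity keeps the first a rows: it is the reduction map from K/t^n K to
    K/t^a K. Padding by zero rows, [untrunc], is a linear section of it that does not commute with t
    in general. *)
Definition trunc X : 'M[F]_(a, d) := pid_mx a *m X.
Definition untrunc (X : 'M[F]_(a, d)) : 'M[F]_(n, d) := pid_mx a *m X.

Lemma truncE X i r : trunc X i r = X (widen_ord le_an i) r.
Proof.
rewrite mxE (bigD1 (widen_ord le_an i)) //= mxE eqxx ltn_ord mul1r big1 ?addr0 // => j ji.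
rewrite mxE; case: eqP => [e|_]; rewrite ?mul0r //.
by case/eqP: ji; apply: val_inj.
Qed.

Lemma untruncK : cancel untrunc trunc.
Proof.
move=> X; rewrite /trunc /untrunc mulmxA mul_pid_mx.
rewrite minnn (minn_idPr le_an) -[RHS]mul1mx; congr (_ *m X).
by rewrite pid_mx_1.
Qed.

Lemma trunc_qtmul X : trunc (qtmul X) = qtmul (trunc X).
Proof.
apply/matrixP => i r; rewrite truncE !mxE.
transitivity (\sum_(b < n | (b < a)%N) if b.+1 == i then X b r else 0).
  rewrite -big_mkcondr; apply: eq_bigl => b /=.
  by case: eqP => e; rewrite ?andbF // andbT ltnW // e ltn_ord.
rewrite (big_ord_narrow le_an) [RHS]big_mkcond; apply: eq_bigr => b _.
by rewrite truncE.
Qed.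

(** Row i of a bracket involves only rows b and b' with b + b' <= i, all of which survive the
    truncation. *)
Lemma trunc_qbracket (c : lie_sc F d) X Y :
  trunc (qbracket c X Y) = qbracket c (trunc X) (trunc Y).
Proof.
apply/matrixP => i k; rewrite truncE !mxE /=.
have narrow (G : 'I_n -> F) : (forall b : 'I_n, (a <= b)%N -> G b = 0) ->
    \sum_(b < n) G b = \sum_(b < a) G (widen_ord le_an b).
  move=> G0; rewrite (bigID (fun b : 'I_n => (b < a)%N)) /= addrC big1 ?add0r.
    by rewrite big_ord_narrow.
  by move=> b; rewrite -leqNgt => /G0.
rewrite narrow => [|b ab]; last first.
  do 3 (rewrite big1 // => ? _); case: ifP => // h.
  by have := leq_trans (leq_ltn_trans (leq_trans (leq_addr _ _) h) (ltn_ord i)) ab; rewrite ltnn.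
apply: eq_bigr => b _; rewrite narrow => [|b' ab]; last first.
  do 2 (rewrite big1 // => ? _); case: ifP => // h.
  by have := leq_trans (leq_ltn_trans (leq_trans (leq_addl _ _) h) (ltn_ord i)) ab; rewrite ltnn.
by do 3 (apply: eq_bigr => ? _); rewrite !truncE.
Qed.

(** Truncation is onto, and its kernel has dimension (n - a) d and is contained in [U]. *)
Lemma trunc_preim_dim (U : {vspace 'M[F]_(n, d)}) (V : {vspace 'M[F]_(a, d)}) :
  (forall X, X \in U <-> trunc X \in V) -> \dim U = (\dim V + (n - a) * d)%N.
Proof.
move=> UV; pose f : 'Hom('M[F]_(n, d), 'M[F]_(a, d)) := linfun (mulmx (pid_mx a)).
have fE X : f X = trunc X by rewrite lfunE.
have surj (W : {vspace 'M[F]_(n, d)}) (W' : {vspace 'M[F]_(a, d)}) :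
    (forall X, X \in W <-> trunc X \in W') -> (f @: W)%VS = W'.
  move=> h; apply/vspaceP => X; apply/memv_imgP/idP => [[Y YW ->]|XW].
    by rewrite fE; apply/h.
  by exists (untrunc X); rewrite ?fE ?untruncK //; apply/h; rewrite untruncK.
have kerU : (U :&: lker f)%VS = lker f.
  apply/capv_idPr/subvP => X; rewrite memv_ker fE => /eqP e.
  by apply/UV; rewrite e mem0v.
rewrite -(limg_ker_dim f U) kerU (surj _ _ UV) addnC; congr (_ + _)%N.
have := limg_ker_dim f fullv; rewrite capfv (surj _ fullv) => [|X]; last by rewrite !memvf.
by rewrite !dimvf /dim /= mulnBl => <-; rewrite addnK.
Qed.

(** Having codimension a, [U] contains the image of t^a, which is the kernel of truncation. So [U]
    is pulled back from its preimage under padding. *)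
Lemma trunc_descent (U : {vspace 'M[F]_(n, d)}) :
  (forall X, X \in U -> qtmul X \in U) -> (\dim U + a = n * d)%N ->
  exists2 V : {vspace 'M[F]_(a, d)}, (\dim V + a = a * d)%N &
    forall X, X \in U <-> trunc X \in V.
Proof.
move=> tU dU.
pose f : 'Hom('M[F]_(a, d), 'M[F]_(n, d)) := linfun (mulmx (pid_mx a)).
have h X : X \in U <-> trunc X \in (f @^-1: U)%VS.
  rewrite -memv_preim lfunE /= -/(untrunc (trunc X)).
  suff : X - untrunc (trunc X) \in U.
    by move=> XU; split=> [?|?]; [rewrite -[untrunc _](subKr X) rpredB|
      rewrite -[X](subrK (untrunc (trunc X))) rpredD].
  (* [Y] is X moved up by a rows, so that t^a Y restores exactly the rows of X from index a on. *)
  pose Y : 'M[F]_(n, d) := \matrix_(i, r) \sum_(j < n | val j == (i + a)%N) X j r.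
  suff -> : X - untrunc (trunc X) = iter a (@qtmul F d n) Y.
    exact: iter_qtmul_codim.
  have t0 : trunc (X - untrunc (trunc X)) = 0.
    by rewrite /trunc mulmxBr -/(trunc _) -/(trunc (untrunc _)) untruncK subrr.
  apply/matrixP => i r; have [ia|ai] := ltnP i a.
    rewrite iter_qtmul_lt //; have /matrixP/(_ (Ordinal ia) r) := t0.
    by rewrite truncE [RHS]mxE; congr (fun_of_matrix _ _ _ = _); apply: val_inj.
  have hia : (i - a < n)%N by apply: leq_ltn_trans (leq_subr _ _) (ltn_ord i).
  rewrite (@iter_qtmul_ge _ _ _ _ _ i (Ordinal hia)) /= ?subnK // [RHS]mxE.
  rewrite (big_pred1 i) => [|j]; last by rewrite /= subnK.
  rewrite mxE.
  rewrite [X in _ + X]mxE [X in _ - X]mxE big1 ?subr0 // => j _.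
  by rewrite mxE ltnNge ai andbF mul0r.
exists (f @^-1: U)%VS => //.
apply/eqP; rewrite -(eqn_add2r ((n - a) * d)); apply/eqP.
by rewrite addnAC -(trunc_preim_dim h) dU -mulnDl addnC subnK.
Qed.

End Truncation.

(** * Submodules of a direct sum *)

Section Submodules.
Variable F : fieldType.

(* [s = true] gives ideals, [s = false] subalgebras. *)
Definition lie_closed (s : bool) d (c : lie_sc F d) n (P : 'M[F]_(n, d) -> Prop) :=
  (forall X, P X -> P (qtmul X)) /\
  (forall X Y, P X -> s \/ P Y -> P (qbracket c Y X)).

Definition Bset (s : bool) d (c : lie_sc F d) n
    (y : 'rV[F]_((n * d - n) * (n * d))) :=
  [/\ (n <= n * d)%N, is_rref (vec_mx y) & lie_closed s c (qmem (vec_mx y))].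

Lemma B_idealE d (c : lie_sc F d) n y : B_ideal c n y <-> Bset true c y.
Proof.
split=> [[[? ? ?] h]|[? ? [? h]]]; first by split=> //; split=> // X Y XA _; apply: h.
by split=> // X Y XA; apply: h => //; left.
Qed.

Lemma B_leE d (c : lie_sc F d) n y : B_le c n y <-> Bset false c y.
Proof.
split=> [[[? ? ?] h]|[? ? [? h]]].
  by split=> //; split=> // X Y XA [//|YA]; apply: h.
by split=> // X Y XA YA; apply: h => //; right.
Qed.

(** The pair of [f1] and [f2] is a surjective morphism to the product. Lifting elements with one
    component equal to 0 isolates the condition on the other component. *)
Lemma lie_closed_preim s n d a1 e1 a2 e2 (c : lie_sc F d) (c1 : lie_sc F e1)
    (c2 : lie_sc F e2) (f1 : 'M[F]_(n, d) -> 'M[F]_(a1, e1))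
    (f2 : 'M[F]_(n, d) -> 'M[F]_(a2, e2)) P P1 P2 :
  (forall X, f1 (qtmul X) = qtmul (f1 X)) -> (forall X, f2 (qtmul X) = qtmul (f2 X)) ->
  (forall X Y, f1 (qbracket c X Y) = qbracket c1 (f1 X) (f1 Y)) ->
  (forall X Y, f2 (qbracket c X Y) = qbracket c2 (f2 X) (f2 Y)) ->
  (forall X1 X2, exists X, f1 X = X1 /\ f2 X = X2) ->
  P1 0 -> P2 0 -> (forall X, P X <-> P1 (f1 X) /\ P2 (f2 X)) ->
  lie_closed s c P <-> lie_closed s c1 P1 /\ lie_closed s c2 P2.
Proof.
move=> t1 t2 b1 b2 sur z1 z2 PE; split; last first.
  case=> -[h1 g1] [h2 g2]; split=> [X /PE[x1 x2]|X Y /PE[x1 x2] sY].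
    by apply/PE; rewrite t1 t2; split; [apply: h1|apply: h2].
  apply/PE; rewrite b1 b2; split; [apply: g1|apply: g2] => //.
    by case: sY => [|/PE[]]; [left|right].
  by case: sY => [|/PE[]]; [left|right].
case=> h g; split; split.
- move=> X1 x1; have [X [e1' e2']] := sur X1 0.
  have /PE[] : P (qtmul X) by apply: h; apply/PE; rewrite e1' e2'.
  by rewrite t1 e1'.
- move=> X1 Y1 x1 sY; have [X [e1' e2']] := sur X1 0; have [Y [u1 u2]] := sur Y1 0.
  have /PE[] : P (qbracket c Y X).
    apply: g; first by apply/PE; rewrite e1' e2'.
    by case: sY => [|?]; [left|right; apply/PE; rewrite u1 u2].
  by rewrite b1 e1' u1.
- move=> X2 x2; have [X [e1' e2']] := sur 0 X2.
  have /PE[] : P (qtmul X) by apply: h; apply/PE; rewrite e1' e2'.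
  by rewrite t2 e2'.
- move=> X2 Y2 x2 sY; have [X [e1' e2']] := sur 0 X2; have [Y [u1 u2]] := sur 0 Y2.
  have /PE[] : P (qbracket c Y X).
    apply: g; first by apply/PE; rewrite e1' e2'.
    by case: sY => [|?]; [left|right; apply/PE; rewrite u1 u2].
  by rewrite b2 e2' u2.
Qed.

End Submodules.

(** * Gluing and splitting submodules of a direct sum *)

Section DirectSum.
Variable F : fieldType.
Variables (d1 d2 : nat) (c1 : lie_sc F d1) (c2 : lie_sc F d2).
Let c := lie_dsum c1 c2.

Fact split_lshift (i : 'I_d1) : split (lshift d2 i) = inl i.
Proof. exact: (unsplitK (inl i)). Qed.
Fact split_rshift (i : 'I_d2) : split (rshift d1 i) = inr i.
Proof. exact: (unsplitK (inr i)). Qed.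

Lemma lsubmx_qtmul n (X : 'M[F]_(n, d1 + d2)) : lsubmx (qtmul X) = qtmul (lsubmx X).
Proof. by rewrite !qtmulE -mulmx_lsub. Qed.

Lemma rsubmx_qtmul n (X : 'M[F]_(n, d1 + d2)) : rsubmx (qtmul X) = qtmul (rsubmx X).
Proof. by rewrite !qtmulE -mulmx_rsub. Qed.

Lemma lsubmx_qbracket n (X Y : 'M[F]_(n, d1 + d2)) :
  lsubmx (qbracket c X Y) = qbracket c1 (lsubmx X) (lsubmx Y).
Proof.
apply/matrixP => a k; rewrite !mxE; do 2 (apply: eq_bigr => ? _).
rewrite big_split_ord /= [X in _ + X]big1 ?addr0 => [|i _]; last first.
  rewrite big1 // => j _; case: ifP => // _.
  by rewrite /c /lie_dsum split_rshift split_lshift; case: split => ?; rewrite mulr0.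
apply: eq_bigr => i _.
rewrite big_split_ord /= [X in _ + X]big1 ?addr0 => [|j _]; last first.
  by case: ifP => // _; rewrite /c /lie_dsum split_rshift split_lshift mulr0.
by apply: eq_bigr => j _; rewrite !mxE /c /lie_dsum !split_lshift.
Qed.

Lemma rsubmx_qbracket n (X Y : 'M[F]_(n, d1 + d2)) :
  rsubmx (qbracket c X Y) = qbracket c2 (rsubmx X) (rsubmx Y).
Proof.
apply/matrixP => a k; rewrite !mxE; do 2 (apply: eq_bigr => ? _).
rewrite big_split_ord /= [X in X + _]big1 ?add0r => [|i _]; last first.
  rewrite big1 // => j _; case: ifP => // _.
  by rewrite /c /lie_dsum split_rshift split_lshift; case: split => ?; rewrite mulr0.
apply: eq_bigr => i _.
rewrite big_split_ord /= [X in X + _]big1 ?add0r => [|j _]; last first.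
  by case: ifP => // _; rewrite /c /lie_dsum split_rshift split_lshift mulr0.
by apply: eq_bigr => j _; rewrite !mxE /c /lie_dsum !split_rshift.
Qed.

(** The left projection maps [U] onto [U1], and the right one maps the kernel of the left one in [U]
    isomorphically onto [U2]. *)
Lemma dsum_dim n (U : {vspace 'M[F]_(n, d1 + d2)}) (U1 : {vspace 'M[F]_(n, d1)})
    (U2 : {vspace 'M[F]_(n, d2)}) :
  (forall X, X \in U <-> lsubmx X \in U1 /\ rsubmx X \in U2) ->
  \dim U = (\dim U1 + \dim U2)%N.
Proof.
move=> UE.
pose f : 'Hom('M[F]_(n, d1 + d2), 'M[F]_(n, d1)) := linfun lsubmx.
pose g : 'Hom('M[F]_(n, d1 + d2), 'M[F]_(n, d2)) := linfun rsubmx.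
have fE X : f X = lsubmx X by rewrite lfunE.
have gE X : g X = rsubmx X by rewrite lfunE.
rewrite -(limg_ker_dim f U) addnC; congr (_ + _)%N.
  congr (\dim _); apply/vspaceP => X1; apply/memv_imgP/idP.
    by case=> X /UE[? _] ->; rewrite fE.
  move=> X1U; exists (row_mx X1 0); rewrite ?fE ?row_mxKl //.
  by apply/UE; rewrite row_mxKl row_mxKr mem0v.
rewrite -(@limg_dim_eq _ _ _ g (U :&: lker f)).
  congr (\dim _); apply/vspaceP => X2; apply/memv_imgP/idP.
    by case=> X /memv_capP[/UE[_ ?] _] ->; rewrite gE.
  move=> X2U; exists (row_mx 0 X2); rewrite ?gE ?row_mxKr //.
  rewrite memv_cap memv_ker fE row_mxKl eqxx andbT.
  by apply/UE; rewrite row_mxKl row_mxKr mem0v.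
apply/eqP; rewrite -subv0; apply/subvP => X.
rewrite !memv_cap !memv_ker fE gE memv0 => /andP[/andP[_ /eqP e1] /eqP e2].
by rewrite -[X]hsubmxK e1 e2 row_mx0.
Qed.

Section Glue.
Variables (s : bool) (n a b : nat) (le_an : (a <= n)%N) (le_bn : (b <= n)%N).

(** [A] codes the direct sum of the submodules coded by [A1] and [A2]. These live modulo t^a and t^b
    instead of t^n, as in the parameter spaces for codimensions a and b. *)
Definition glue_rel k k1 k2 (A : 'M[F]_(k, n * (d1 + d2))) (A1 : 'M[F]_(k1, a * d1))
    (A2 : 'M[F]_(k2, b * d2)) :=
  forall X : 'M[F]_(n, d1 + d2),
    qmem A X <-> qmem A1 (trunc a (lsubmx X)) /\ qmem A2 (trunc b (rsubmx X)).

Lemma lie_closed_glue P (P1 : 'M[F]_(a, d1) -> Prop) (P2 : 'M[F]_(b, d2) -> Prop) :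
  P1 0 -> P2 0 ->
  (forall X, P X <-> P1 (trunc a (lsubmx X)) /\ P2 (trunc b (rsubmx X))) ->
  @lie_closed F s _ c n P <-> lie_closed s c1 P1 /\ lie_closed s c2 P2.
Proof.
apply: (@lie_closed_preim F s n _ a _ b _ c c1 c2
  (fun X => trunc a (lsubmx X)) (fun X => trunc b (rsubmx X))).
- by move=> X; rewrite lsubmx_qtmul trunc_qtmul.
- by move=> X; rewrite rsubmx_qtmul trunc_qtmul.
- by move=> X Y; rewrite lsubmx_qbracket trunc_qbracket.
- by move=> X Y; rewrite rsubmx_qbracket trunc_qbracket.
move=> X1 X2; exists (row_mx (untrunc n X1) (untrunc n X2)).
by rewrite row_mxKl row_mxKr !untruncK.
Qed.

Lemma glue_dim (U : {vspace 'M[F]_(n, d1 + d2)}) (U1 : {vspace 'M[F]_(a, d1)})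
    (U2 : {vspace 'M[F]_(b, d2)}) :
  (forall X, X \in U <-> trunc a (lsubmx X) \in U1 /\ trunc b (rsubmx X) \in U2) ->
  \dim U = ((\dim U1 + (n - a) * d1) + (\dim U2 + (n - b) * d2))%N.
Proof.
move=> UE.
pose f1 : 'Hom('M[F]_(n, d1), 'M[F]_(a, d1)) := linfun (mulmx (pid_mx a)).
pose f2 : 'Hom('M[F]_(n, d2), 'M[F]_(b, d2)) := linfun (mulmx (pid_mx b)).
have m1 X : X \in (f1 @^-1: U1)%VS <-> trunc a X \in U1 by rewrite -memv_preim lfunE.
have m2 X : X \in (f2 @^-1: U2)%VS <-> trunc b X \in U2 by rewrite -memv_preim lfunE.
rewrite -(trunc_preim_dim le_an m1) -(trunc_preim_dim le_bn m2).
by apply: dsum_dim => X; rewrite UE m1 m2.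
Qed.

Lemma qmem0 n' d' k (A : 'M[F]_(k, n' * d')) : qmem A 0.
Proof. by rewrite /qmem linear0 sub0mx. Qed.

Lemma glue_rel_uniq k k1 k2 (A A' : 'M[F]_(k, n * (d1 + d2))) (A1 : 'M[F]_(k1, a * d1))
    (A2 : 'M[F]_(k2, b * d2)) :
  is_rref A -> is_rref A' -> glue_rel A A1 A2 -> glue_rel A' A1 A2 -> A = A'.
Proof. by move=> rA rA' h h'; apply: (qmem_rref_inj rA rA') => X; rewrite h h'. Qed.

Lemma glue_rel_uniql k k1 k2 (A : 'M[F]_(k, n * (d1 + d2))) (A1 A1' : 'M[F]_(k1, a * d1))
    (A2 A2' : 'M[F]_(k2, b * d2)) :
  is_rref A1 -> is_rref A1' -> glue_rel A A1 A2 -> glue_rel A A1' A2' -> A1 = A1'.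
Proof.
move=> r r' h h'; apply: (qmem_rref_inj r r') => X1.
have := h (row_mx (untrunc n X1) 0); have := h' (row_mx (untrunc n X1) 0).
rewrite row_mxKl row_mxKr untruncK // /trunc mulmx0.
have := qmem0 A2; have := qmem0 A2'; tauto.
Qed.

Lemma glue_rel_uniqr k k1 k2 (A : 'M[F]_(k, n * (d1 + d2))) (A1 A1' : 'M[F]_(k1, a * d1))
    (A2 A2' : 'M[F]_(k2, b * d2)) :
  is_rref A2 -> is_rref A2' -> glue_rel A A1 A2 -> glue_rel A A1' A2' -> A2 = A2'.
Proof.
move=> r r' h h'; apply: (qmem_rref_inj r r') => X2.
have := h (row_mx 0 (untrunc n X2)); have := h' (row_mx 0 (untrunc n X2)).
rewrite row_mxKl row_mxKr untruncK // /trunc mulmx0.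
have := qmem0 A1; have := qmem0 A1'; tauto.
Qed.

(** Stability under the projection to L, which amounts to being the sum of the intersections with L
    and N. *)
Definition split_stable k (A : 'M[F]_(k, n * (d1 + d2))) :=
  forall X : 'M[F]_(n, d1 + d2), qmem A X -> qmem A (row_mx (lsubmx X) 0).

Lemma glue_rel_split k k1 k2 (A : 'M[F]_(k, n * (d1 + d2))) (A1 : 'M[F]_(k1, a * d1))
    (A2 : 'M[F]_(k2, b * d2)) : glue_rel A A1 A2 -> split_stable A.
Proof.
move=> h X /h[x1 x2]; apply/h; rewrite row_mxKl row_mxKr; split=> //.
by rewrite /trunc mulmx0; apply: qmem0.
Qed.

End Glue.

(** The codimensions a and n - a add up to n, so the direct sum has an echelon matrix of the
    expected size. *)
Lemma glue_exists s n a (y1 : 'rV_((a * d1 - a) * (a * d1)))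
    (y2 : 'rV_(((n - a) * d2 - (n - a)) * ((n - a) * d2))) :
  (a <= n)%N -> Bset s c1 y1 -> Bset s c2 y2 ->
  exists2 y : 'rV_((n * (d1 + d2) - n) * (n * (d1 + d2))),
    Bset s c y & glue_rel (vec_mx y) (vec_mx y1) (vec_mx y2).
Proof.
move=> an [ge1 r1 cl1] [ge2 r2 cl2].
have bn := leq_subr a n.
have [U1 d_U1 U1E] := qmem_vspace (rref_free r1).
have [U2 d_U2 U2E] := qmem_vspace (rref_free r2).
pose f1 : 'Hom('M[F]_(n, d1 + d2), 'M[F]_(a, d1)) :=
  linfun (mulmx (pid_mx a) \o lsubmx).
pose f2 : 'Hom('M[F]_(n, d1 + d2), 'M[F]_(n - a, d2)) :=
  linfun (mulmx (pid_mx (n - a)) \o rsubmx).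
pose U := ((f1 @^-1: U1) :&: (f2 @^-1: U2))%VS.
have UE X : X \in U <-> trunc a (lsubmx X) \in U1 /\ trunc (n - a) (rsubmx X) \in U2.
  rewrite memv_cap -!memv_preim !lfunE /=; split; last by case=> -> ->.
  by case/andP.
have le_n : (n <= n * (d1 + d2))%N.
  rewrite -{1}(subnK an) mulnDr addnC leq_add //.
    by apply: leq_trans ge1 _; rewrite leq_mul2r an orbT.
  by apply: leq_trans ge2 _; rewrite leq_mul2r bn orbT.
have dU : \dim U = (n * (d1 + d2) - n)%N.
  rewrite (glue_dim an bn UE) d_U1 d_U2 (subKn an).
  have e1 : (a * d1 + (n - a) * d1 = n * d1)%N by rewrite -mulnDl subnKC.
  have e2 : ((n - a) * d2 + a * d2 = n * d2)%N by rewrite -mulnDl subnK.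
  rewrite mulnDr; lia.
have [A rA AE] := vspace_rref dU.
have gA : glue_rel A (vec_mx y1) (vec_mx y2).
  by move=> X; rewrite AE UE -U1E -U2E.
exists (mxvec A); rewrite /Bset mxvecK //; split=> //.
by have [_ h] := @lie_closed_glue s n a (n - a) an bn (fun X => qmem A X)
  (fun X => qmem (vec_mx y1) X) (fun X => qmem (vec_mx y2) X) (qmem0 _) (qmem0 _) gA; apply: h.
Qed.

(** A split submodule is the sum of its projections. Each projection is stable under t and descends
    to the quotient by the power of t given by its own codimension. *)
Lemma unglue s n (y : 'rV_((n * (d1 + d2) - n) * (n * (d1 + d2)))) :
  Bset s c y -> split_stable (vec_mx y) ->
  exists2 a, (a <= n)%N &
  exists y1 : 'rV_((a * d1 - a) * (a * d1)),
  exists y2 : 'rV_(((n - a) * d2 - (n - a)) * ((n - a) * d2)),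
    [/\ Bset s c1 y1, Bset s c2 y2 & glue_rel (vec_mx y) (vec_mx y1) (vec_mx y2)].
Proof.
case=> le_n rA clA spl.
have [U dU UE] := qmem_vspace (rref_free rA).
pose f : 'Hom('M[F]_(n, d1 + d2), 'M[F]_(n, d1)) := linfun lsubmx.
pose g : 'Hom('M[F]_(n, d1 + d2), 'M[F]_(n, d2)) := linfun rsubmx.
pose U1 := (f @: U)%VS; pose U2 := (g @: U)%VS.
have splU X : X \in U <-> lsubmx X \in U1 /\ rsubmx X \in U2.
  split=> [XU|[]].
    by have := memv_img f XU; have := memv_img g XU; rewrite !lfunE.
  case/memv_imgP => Y YU; rewrite lfunE /= => eY.
  case/memv_imgP => Z ZU; rewrite lfunE /= => eZ.
  (* The left part of X comes from Y and the right part from Z; stability under the projection to L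
     keeps both in [U]. *)
  have -> : X = row_mx (lsubmx Y) 0 + (Z - row_mx (lsubmx Z) 0).
    have -> : Z - row_mx (lsubmx Z) 0 = row_mx 0 (rsubmx Z).
      by rewrite -{1}[Z]hsubmxK opp_row_mx add_row_mx subrr subr0.
    by rewrite add_row_mx addr0 add0r -eY -eZ hsubmxK.
  rewrite rpredD ?rpredB //; first by apply/UE/spl/UE.
  by apply/UE/spl/UE.
have dsum := dsum_dim splU.
have tU X : X \in U -> qtmul X \in U by move=> /UE/clA.1/UE.
have tU1 X : X \in U1 -> qtmul X \in U1.
  case/memv_imgP => Y YU ->; rewrite lfunE /= -lsubmx_qtmul.
  by have /splU[] := tU _ YU.
have tU2 X : X \in U2 -> qtmul X \in U2.
  case/memv_imgP => Y YU ->; rewrite lfunE /= -rsubmx_qtmul.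
  by have /splU[] := tU _ YU.
have le1 : (\dim U1 <= n * d1)%N.
  by apply: leq_trans (dimvS (subvf _)) _; rewrite dimvf.
have le2 : (\dim U2 <= n * d2)%N.
  by apply: leq_trans (dimvS (subvf _)) _; rewrite dimvf.
(* The index a is the codimension of the left projection; that of the right one is then n - a by
   additivity of dimensions. *)
pose a := (n * d1 - \dim U1)%N.
have ea : (\dim U1 + a = n * d1)%N by rewrite subnKC.
have eb' : (\dim U2 + (n * d2 - \dim U2) = n * d2)%N by rewrite subnKC.
have eab : (a + (n * d2 - \dim U2) = n)%N.
  apply/eqP; rewrite -(eqn_add2l (\dim U)) {1}dsum addnACA ea eb' -mulnDr dU.
  by rewrite subnK.
have an : (a <= n)%N by rewrite -eab leq_addr.
have eb : (\dim U2 + (n - a) = n * d2)%N by rewrite -[X in (X - a)%N]eab addKn.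
have bn := leq_subr a n.
have [V1 dV1 V1E] := trunc_descent an tU1 ea.
have [V2 dV2 V2E] := trunc_descent bn tU2 eb.
have [A1 r1 A1E] := vspace_rref (k := (a * d1 - a)%N)
  (etrans (esym (addnK a _)) (f_equal (subn^~ a) dV1)).
have [A2 r2 A2E] := vspace_rref (k := ((n - a) * d2 - (n - a))%N)
  (etrans (esym (addnK (n - a) _)) (f_equal (subn^~ (n - a)%N) dV2)).
have gA : glue_rel (vec_mx y) A1 A2.
  by move=> X; rewrite UE splU V1E V2E A1E A2E.
have [cl1 cl2] := (@lie_closed_glue s n a (n - a) an bn (fun X => qmem (vec_mx y) X)
  (fun X => qmem A1 X) (fun X => qmem A2 X) (qmem0 _) (qmem0 _) gA).1 clA.
exists a => //; exists (mxvec A1), (mxvec A2); rewrite /Bset !mxvecK; split=> //.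
  by split=> //; rewrite -dV1 leq_addl.
by split=> //; rewrite -dV2 leq_addl.
Qed.

(** Both decompositions pull back to the same subspace modulo t^n, the intersection with L, and a is
    its codimension. *)
Lemma glue_rel_codim s n a a' (y : 'rV_((n * (d1 + d2) - n) * (n * (d1 + d2))))
    (y1 : 'rV_((a * d1 - a) * (a * d1))) y2
    (y1' : 'rV_((a' * d1 - a') * (a' * d1))) y2' :
  (a <= n)%N -> (a' <= n)%N ->
  Bset s c1 y1 -> Bset s c1 y1' ->
  @glue_rel n a (n - a) _ _ ((n - a) * d2 - (n - a)) (vec_mx y) (vec_mx y1) (vec_mx y2) ->
  @glue_rel n a' (n - a') _ _ ((n - a') * d2 - (n - a')) (vec_mx y) (vec_mx y1') (vec_mx y2') ->
  a = a'.
Proof.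
move=> an an' [ge r _] [ge' r' _] h h'.
have [V dV VE] := qmem_vspace (rref_free r).
have [V' dV' VE'] := qmem_vspace (rref_free r').
pose f : 'Hom('M[F]_(n, d1), 'M[F]_(a, d1)) := linfun (mulmx (pid_mx a)).
have m X : X \in (f @^-1: V)%VS <-> trunc a X \in V by rewrite -memv_preim lfunE.
have m' X : X \in (f @^-1: V)%VS <-> trunc a' X \in V'.
  rewrite m -VE -VE'; have := h (row_mx X 0); have := h' (row_mx X 0).
  rewrite row_mxKl row_mxKr /trunc !mulmx0.
  have := qmem0 (vec_mx y2); have := qmem0 (vec_mx y2'); tauto.
have := trunc_preim_dim an' m'; rewrite (trunc_preim_dim an m) dV dV'.
have e1 : (a * d1 + (n - a) * d1 = n * d1)%N by rewrite -mulnDl subnKC.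
have e2 : (a' * d1 + (n - a') * d1 = n * d1)%N by rewrite -mulnDl subnKC.
lia.
Qed.

End DirectSum.

(** * Torus action on Schubert cells *)

Section Definability.
Variable F : closedFieldType.

Lemma constructible_lie_closed s d (c : lie_sc F d) n m k
    (A : 'rV[F]_m -> 'M[F]_(k, n * d)) :
  polymx A -> constructible (fun z => lie_closed s c (qmem (A z))).
Proof.
move=> hA; apply: constructible_and.
  apply: constructible_forall_mx.
  have pl := polymx_lsub (@polymx_id F (m + n * d)).
  have pX := polymx_vec (polymx_rsub (@polymx_id F (m + n * d))).
  have hA' := polymx_comp hA pl.
  by apply: constructible_imp; apply: constructible_qmem => //; apply: polymx_qtmul.
apply: constructible_forall_mx; apply: constructible_forall_mx.
set M := (m + n * d + n * d)%N.
have pl := polymx_lsub (@polymx_id F M).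
have pY := polymx_vec (polymx_rsub (@polymx_id F M)).
have pX := polymx_vec (polymx_rsub pl).
have hA' := polymx_comp hA (polymx_lsub pl).
apply: constructible_imp; first exact: constructible_qmem.
apply: constructible_imp; last by apply: constructible_qmem => //; apply: polymx_qbracket.
by apply: cons_union; [apply: constructible_const | apply: constructible_qmem].
Qed.

Lemma constructible_rref_at m k N (A : 'rV[F]_m -> 'M[F]_(k, N)) (p : 'I_k -> 'I_N) :
  polymx A -> constructible (fun z => rref_at (A z) p).
Proof.
move=> hA.
have cE i j c : constructible (fun z => A z i j = c).
  by apply: constructible_eq; [apply: hA | apply: polyf_const].
have h : constructible (fun z =>
  (forall i j : 'I_k, (i < j)%N -> (p i < p j)%N) /\
  (forall i, A z i (p i) = 1) /\
  (forall i (j : 'I_N), (j < p i)%N -> A z i j = 0) /\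
  (forall i i', i' != i -> A z i' (p i) = 0)).
  apply: constructible_and; first exact: constructible_const.
  apply: constructible_and; first by apply: constructible_allfin.
  apply: constructible_and; do 2 (apply: constructible_allfin => ?).
    by apply: constructible_imp => //; apply: constructible_const.
  by apply: constructible_imp => //; apply: constructible_const.
by apply: (cons_ext h) => z; split=> [[? [? []]]|[]].
Qed.

(** Pivot functions now range over a finite type, so the existential becomes a finite union of
    cells. *)
Lemma is_rrefE k N (A : 'M[F]_(k, N)) :
  is_rref A <-> exists p : {ffun 'I_k -> 'I_N}, rref_at A p.
Proof.
split=> [[p [h1 h2 h3 h4]]|[p rA]]; last by exists p.
by exists (finfun p); split=> [i j|i|i j|i i']; rewrite ?ffunE;
  [exact: h1|exact: h2|exact: h3|exact: h4].
Qed.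

Lemma constructible_Bset s d (c : lie_sc F d) n : constructible (@Bset F s d c n).
Proof.
have pA := polymx_vec (@polymx_id F ((n * d - n) * (n * d))).
have h : constructible (fun y : 'rV_((n * d - n) * (n * d)) => (n <= n * d)%N /\
   (exists p : {ffun 'I_(n * d - n) -> 'I_(n * d)}, rref_at (vec_mx y) p) /\
   lie_closed s c (qmem (vec_mx y : 'M[F]_(n * d - n, n * d)))).
  apply: constructible_and; first exact: constructible_const.
  apply: constructible_and; last exact: constructible_lie_closed.
  by apply: constructible_exfin => p; apply: constructible_rref_at.
by apply: (cons_ext h) => y; rewrite -is_rrefE; split=> [[? []]|[]].
Qed.

Lemma constructible_glue_rel m n a b d1 d2 k k1 k2
    (A : 'rV[F]_m -> 'M[F]_(k, n * (d1 + d2))) (A1 : 'rV[F]_m -> 'M[F]_(k1, a * d1))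
    (A2 : 'rV[F]_m -> 'M[F]_(k2, b * d2)) :
  polymx A -> polymx A1 -> polymx A2 ->
  constructible (fun z => glue_rel (A z) (A1 z) (A2 z)).
Proof.
move=> hA hA1 hA2; apply: constructible_forall_mx.
set M := (m + n * (d1 + d2))%N.
have pl := polymx_lsub (@polymx_id F M).
have pX := polymx_vec (polymx_rsub (@polymx_id F M)).
apply: constructible_iff; first exact/constructible_qmem/pX/(polymx_comp hA).
apply: constructible_and; apply: constructible_qmem; first exact: (polymx_comp hA1).
- by apply: polymx_mul; [apply: polymx_const | apply: polymx_lsub].
- exact: (polymx_comp hA2).
- by apply: polymx_mul; [apply: polymx_const | apply: polymx_rsub].
Qed.

End Definability.

(** * Diagonal scalings of the coordinates *)

Section Scaling.
Variable F : fieldType.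
Variables (s : bool) (d : nat) (c : lie_sc F d) (n : nat).

Definition scale_cols (w : 'I_d -> F) (X : 'M[F]_(n, d)) : 'M[F]_(n, d) :=
  \matrix_(a, r) (X a r * w r).

(* For [s = false] the scaling is an automorphism, for [s = true] it commutes
   with all inner derivations. *)
Definition bracket_scaling (w : 'I_d -> F) :=
  forall i j k e, (if s then 1 else w i) * w j * c i j k e = w k * c i j k e.

Lemma scale_cols_qtmul w (X : 'M[F]_(n, d)) :
  scale_cols w (qtmul X) = qtmul (scale_cols w X).
Proof.
by apply/matrixP => i r; rewrite !mxE mulr_suml; apply: eq_bigr => b _; rewrite mxE.
Qed.

Lemma scale_cols_qbracket w (X Y : 'M[F]_(n, d)) : bracket_scaling w ->
  scale_cols w (qbracket c Y X) =
  qbracket c (if s then Y else scale_cols w Y) (scale_cols w X).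
Proof.
move=> hw; apply/matrixP => a k; rewrite !mxE.
do 4 (rewrite mulr_suml; apply: eq_bigr => ? _).
case: ifP => _; rewrite ?mul0r // -mulrA [c _ _ _ _ * _]mulrC -hw.
by case: (s); rewrite !mxE; ring.
Qed.

Lemma scale_colsK w w' : (forall r, w r * w' r = 1) ->
  cancel (scale_cols w) (scale_cols w').
Proof. by move=> h X; apply/matrixP => a r; rewrite !mxE -mulrA h mulr1. Qed.

Lemma lie_closed_scale w w' (P P' : 'M[F]_(n, d) -> Prop) :
  bracket_scaling w -> (forall r, w r * w' r = 1) ->
  (forall X, P' (scale_cols w X) <-> P X) -> lie_closed s c P -> lie_closed s c P'.
Proof.
move=> hw ww' PP' [h g].
have sK : cancel (scale_cols w') (scale_cols w).
  by apply: scale_colsK => r; rewrite mulrC.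
split=> [X|X Y]; first by rewrite -[X]sK -scale_cols_qtmul !PP'; apply: h.
rewrite -[X]sK PP' => PX sY.
(* For ideals the second argument is arbitrary and stays put; for subalgebras it is scaled back into
   [P]. *)
have [Y' [PY' ->]] : exists Y', (s \/ P Y') /\ Y = (if s then Y' else scale_cols w Y').
  move: sY; case: (s) => sY; first by exists Y; split; [left|].
  by exists (scale_cols w' Y); rewrite sK; split=> //; right; case: sY => // ; rewrite -PP' sK.
by rewrite -scale_cols_qbracket // PP'; apply: g.
Qed.

End Scaling.

(** * Torus action in echelon coordinates *)

Section TorusOnCells.
Variable F : closedFieldType.
Variables (n d k : nat).
Implicit Types (wt : 'I_d -> int) (p : 'I_k -> 'I_(n * d)).

(** The flattened coordinate of t^a x_r has the weight of x_r: t itself has weight 0. *)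
Definition col_weight wt (j : 'I_(n * d)) : int := mxvec (\matrix_(a < n, r < d) wt r) 0 j.

(* Scaling the columns of an echelon form and renormalizing the pivots to 1
   multiplies the entry (i, j) by z to this weight. *)
Definition cell_weight wt p (q : 'I_(k * (n * d))) : int :=
  mxvec (\matrix_(i, j) (col_weight wt j - col_weight wt (p i))) 0 q.

Lemma torus_act_cell wt p z (y : 'rV[F]_(k * (n * d))) i j :
  vec_mx (torus_act (cell_weight wt p) z y) i j =
  z ^ (col_weight wt j - col_weight wt (p i)) * vec_mx y i j.
Proof. by rewrite !mxE /cell_weight mxvecE mxE. Qed.

Lemma torus_act_rref wt p z (y : 'rV[F]_(k * (n * d))) :
  rref_at (vec_mx y) p -> rref_at (vec_mx (torus_act (cell_weight wt p) z y)) p.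
Proof.
case=> h1 h2 h3 h4; split=> // [i|i j ji|i i' ne]; rewrite torus_act_cell.
- by rewrite h2 subrr expr0z mulr1.
- by rewrite h3 // mulr0.
- by rewrite h4 // mulr0.
Qed.

(** The new matrix is E A D, where D scales the columns and E brings the pivots back to 1. As E is
    invertible, the row space is that of A D, the scaled submodule. *)
Lemma torus_act_qmem wt p z (y : 'rV[F]_(k * (n * d))) X : z != 0 ->
  qmem (vec_mx (torus_act (cell_weight wt p) z y)) (scale_cols (fun r => z ^ wt r) X)
  = qmem (vec_mx y) X.
Proof.
move=> nz; rewrite /qmem.
pose D : 'M[F]_(n * d) := diag_mx (\row_j z ^ col_weight wt j).
pose E : 'M[F]_k := diag_mx (\row_i z ^ (- col_weight wt (p i))).
have uD : D \in unitmx.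
  rewrite unitmxE det_diag unitfE; apply/prodf_neq0 => j _.
  by rewrite mxE expfz_neq0.
have uE : E \in unitmx.
  rewrite unitmxE det_diag unitfE; apply/prodf_neq0 => j _.
  by rewrite mxE expfz_neq0.
have -> : vec_mx (torus_act (cell_weight wt p) z y) = E *m vec_mx y *m D.
  apply/matrixP => i j; rewrite torus_act_cell mul_diag_mx mul_mx_diag !mxE.
  by rewrite expfzDr //; set u := _ ^ _; set v := _ ^ _; rewrite [RHS]mulrC mulrA.
have -> : mxvec (scale_cols (fun r => z ^ wt r) X) = mxvec X *m D.
  apply/rowP => j; rewrite mul_mx_diag !mxE; case/mxvec_indexP: j => a r.
  by rewrite !mxvecE /col_weight mxvecE !mxE.
rewrite submxMfree ?row_free_unit //.
by rewrite (eqmxMfull _ (_ : row_full E)) // row_full_unit.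
Qed.

Lemma torus_act_Bset_cell s (c : lie_sc F d) wt p z (y : 'rV[F]_(k * (n * d))) :
  z != 0 -> bracket_scaling s c (fun r => z ^ wt r) ->
  lie_closed s c (qmem (vec_mx y)) ->
  lie_closed s c (qmem (vec_mx (torus_act (cell_weight wt p) z y))).
Proof.
move=> nz hw; apply: (lie_closed_scale hw (w' := fun r => z ^ (- wt r))).
  by move=> r; rewrite -expfzDr // subrr expr0z.
by move=> X; rewrite torus_act_qmem.
Qed.

End TorusOnCells.

(** * Split submodules in echelon coordinates *)

Section SplitCells.
Variable F : fieldType.
Variables (n d1 d2 k : nat).
Implicit Types (A : 'M[F]_(k, n * (d1 + d2))) (p : 'I_k -> 'I_(n * (d1 + d2))).

Definition left_col (j : 'I_(n * (d1 + d2))) : bool :=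
  mxvec (\matrix_(a < n, r < d1 + d2) (r < d1)%N) 0 j.

Lemma mxvec_left (X : 'M[F]_(n, d1 + d2)) j :
  mxvec (row_mx (lsubmx X) 0) 0 j = if left_col j then mxvec X 0 j else 0.
Proof.
case/mxvec_indexP: j => a r; rewrite /left_col !mxvecE !mxE.
case: splitP => r' e; last by rewrite mxE.
by rewrite mxE; congr (X _ _); apply: val_inj.
Qed.

(** The left part of row i vanishes at every pivot except possibly the i-th, so if it lies in the
    row space it is row i or 0, according to the side of that pivot. Hence splitting means that each
    row lives on the side of its pivot. *)
Lemma split_stable_cell A p : rref_at A p ->
  split_stable A <-> forall i j, left_col j != left_col (p i) -> A i j = 0.
Proof.
move=> rA; split=> [spl i j ne|h X].
  have rowi : qmem A (vec_mx (row i A) : 'M_(n, d1 + d2)).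
    by rewrite /qmem vec_mxK row_sub.
  have e := rref_comb rA (spl _ rowi).
  have {e} : mxvec (row_mx (lsubmx (vec_mx (row i A))) 0) =
      (if left_col (p i) then 1 else 0) *: row i A.
    rewrite e mulmx_sum_row (bigD1 i) //= mxE mxvec_left vec_mxK mxE.
    have [_ -> _ p0] := rA; rewrite big1 ?addr0 // => i' ne'.
    by rewrite mxE mxvec_left vec_mxK mxE p0 1?eq_sym // if_same scale0r.
  move/rowP/(_ j); rewrite mxvec_left vec_mxK !mxE.
  move: ne; case: (left_col j); case: (left_col (p i)) => // _.
    by rewrite mul0r.
  by rewrite mul1r.
move=> XA; apply/submxP.
(* Rows stay on one side, so the left part of X is obtained by keeping the coefficients of the left
   pivots. *)
exists (\row_i (if left_col (p i) then mxvec X 0 (p i) else 0)).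
apply/rowP => j; rewrite mxvec_left {1}(rref_comb rA XA) !mxE.
case: ifP => lj.
  apply: eq_bigr => i _; rewrite !mxE; case: ifP => // li.
  by rewrite h ?mulr0 // lj li.
rewrite big1 // => i _; rewrite mxE; case: ifP => // li; last by rewrite mul0r.
by rewrite h ?mulr0 // lj li.
Qed.

End SplitCells.

(** * Multiplicativity *)

Section Multiplicativity.
Variable F : closedFieldType.
Variable chi : forall m, ('rV[F]_m -> Prop) -> int.
Hypothesis chiP : is_euler_char chi.
Variables (d1 d2 : nat) (c1 : lie_sc F d1) (c2 : lie_sc F d2) (s : bool).
Let c := lie_dsum c1 c2.

(** A torus that fixes N pointwise, moves the j-th basis vector of L and permutes the submodules
    counted. It may depend on j, as the given automorphisms do. *)
Definition separating_weight (wt : 'I_(d1 + d2) -> int) (j : 'I_d1) :=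
  [/\ wt (lshift d2 j) != 0, forall r, wt (rshift d1 r) = 0 &
      forall z : F, z != 0 -> bracket_scaling s c (fun r => z ^ wt r)].

(** The set is cut into Schubert cells. In each cell the entries whose column and pivot lie on
    different sides have nonzero weight for some torus and can be set to 0; what remains are the
    split submodules. *)
Lemma chi_Bset_split n : (forall j, exists wt, separating_weight wt j) ->
  chi (@Bset F s _ c n) = chi (fun y => @Bset F s _ c n y /\ split_stable (vec_mx y)).
Proof.
move=> sepP.
pose k := (n * (d1 + d2) - n)%N.
pose cell (p : {ffun 'I_k -> 'I_(n * (d1 + d2))}) y := Bset s c y /\ rref_at (vec_mx y) p.
have c_cell p : constructible (cell p).
  apply: constructible_and; first exact: constructible_Bset.
  exact/constructible_rref_at/polymx_vec/polymx_id.
pose mixed (p : 'I_k -> 'I_(n * (d1 + d2))) (q : 'I_(k * (n * (d1 + d2)))) : bool :=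
  mxvec (\matrix_(i, j) (left_col j != left_col (p i))) 0 q.
pose fixed p (y : 'rV[F]_(k * (n * (d1 + d2)))) :=
  cell p y /\ forall q, q \in [seq q <- enum 'I_(k * (n * (d1 + d2))) | mixed p q] -> y 0 q = 0.
have c_fixed p : constructible (fixed p).
  apply: constructible_and => //; apply: constructible_allfin => q.
  apply: constructible_imp; first exact: constructible_const.
  by apply: constructible_eq; [apply: polymx_id | apply: polyf_const].
have cell_uniq p p' y : cell p y -> cell p' y -> p = p'.
  by move=> [_ rp] [_ rp']; apply/ffunP; apply: rref_at_inj rp rp'.
transitivity (\sum_p chi (cell p)).
  rewrite -(chi_exfin chiP c_cell cell_uniq); apply: chi_ext => y.
  split=> [By|[p []//]]; have [_ rA _] := By.
  by have /is_rrefE[p rp] := rA; exists p.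
transitivity (\sum_p chi (fixed p)); last first.
  rewrite -(chi_exfin chiP c_fixed) => [|p p' y [py _] [p'y _]]; last exact: cell_uniq py p'y.
  apply: chi_ext => y; split=> [[p [[By rp] y0]]|[By spl]].
    split=> //; apply/(split_stable_cell rp) => i j ne.
    by rewrite mxE y0 // mem_filter mem_enum andbT /mixed mxvecE mxE.
  have [_ /is_rrefE[p rp] _] := By; exists p; split=> // q.
  rewrite mem_filter mem_enum andbT; case/mxvec_indexP: q => i j.
  rewrite /mixed mxvecE mxE => /((split_stable_cell rp).1 spl).
  by rewrite mxE.
apply: eq_bigr => p _.
(* All admissible tori are used together, since different mixed entries may need different ones. *)
pose J := {wt : 'I_(d1 + d2) -> int |
  forall z : F, z != 0 -> bracket_scaling s c (fun r => z ^ wt r)}.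
apply: (@chi_torus_fixed F chi chiP _ J (fun wt => cell_weight (sval wt) p)) => //.
  move=> [wt wtP] z y nz [[le_n rA cl] rp] /=.
  have rp' := torus_act_rref wt z rp.
  split=> //; split=> //; first by exists p.
  by apply: torus_act_Bset_cell => //; apply: wtP.
move=> q; rewrite mem_filter mem_enum andbT; case/mxvec_indexP: q => i j.
rewrite /mixed mxvecE mxE.
have colP (l : 'I_(n * (d1 + d2))) :
    if left_col l
    then exists j, forall wt, separating_weight wt j -> col_weight wt l != 0
    else forall wt j, separating_weight wt j -> col_weight wt l = 0.
  case/mxvec_indexP: l => a r; rewrite /left_col mxvecE mxE.
  case: ifP => hr.
    exists (Ordinal hr) => wt [wr _ _]; rewrite /col_weight mxvecE mxE.
    by rewrite (_ : r = lshift d2 (Ordinal hr)) //; apply: val_inj.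
  move=> wt b [_ w0 _]; rewrite /col_weight mxvecE mxE.
  rewrite -(splitK r); case: splitP => r' e; last exact: w0.
  by rewrite e ltn_ord in hr.
have cw wt : cell_weight wt p (mxvec_index i j) = col_weight wt j - col_weight wt (p i).
  by rewrite /cell_weight mxvecE mxE.
(* Exactly one of the two columns is left, so the difference of weights is, up to sign, the weight
   of the left one. *)
move: (colP j) (colP (p i)); case: (left_col j); case: (left_col (p i)) => // h h' _.
  have [b hb] := h; have [wt sep] := sepP b; have [_ _ ok] := sep.
  by exists (exist _ wt ok); rewrite /= cw (h' _ _ sep) subr0 (hb _ sep).
have [b hb] := h'; have [wt sep] := sepP b; have [_ _ ok] := sep.
by exists (exist _ wt ok); rewrite /= cw (h _ _ sep) sub0r oppr_eq0 (hb _ sep).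
Qed.

(** Split submodules are sorted by the codimension a of their left part; for each a, gluing is a
    constructible bijection from pairs of submodules. *)
Lemma chi_split_sum n :
  chi (fun y => @Bset F s _ c n y /\ split_stable (vec_mx y)) =
  \sum_(a < n.+1) chi (@Bset F s _ c1 a) * chi (@Bset F s _ c2 (n - a)).
Proof.
pose P (a : 'I_n.+1) z := @Bset F s _ c1 a (lsubmx z) /\ @Bset F s _ c2 (n - a) (rsubmx z).
pose G (a : 'I_n.+1) z y := @glue_rel F d1 d2 n a (n - a) _ _ _
  (vec_mx y : 'M_(n * (d1 + d2) - n, n * (d1 + d2)))
  (vec_mx (lsubmx z) : 'M_(a * d1 - a, _))
  (vec_mx (rsubmx z) : 'M_((n - a) * d2 - (n - a), _)).
(* [S a] is the image of the gluing of pairs, and is constructible as a projection. *)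
pose S a y := exists z, P a z /\ (@Bset F s _ c n y /\ G a z y).
have le_a (a : 'I_n.+1) : (a <= n)%N by rewrite -ltnS.
have c_P a : constructible (P a) by apply: constructible_prod; apply: constructible_Bset.
have c_G m a (Z : 'rV[F]_m -> 'rV[F]_(_ + _)) Y : polymx Z -> polymx Y ->
    constructible (fun x => G a (Z x) (Y x)).
  move=> pZ pY; apply: constructible_glue_rel; first exact: polymx_vec.
    exact/polymx_vec/polymx_lsub.
  exact/polymx_vec/polymx_rsub.
have c_S a : constructible (S a).
  apply: constructible_exists.
  have pl := fun m p => polymx_lsub (@polymx_id F (m + p)).
  have pr := fun m p => polymx_rsub (@polymx_id F (m + p)).
  apply: constructible_and; first exact: (constructible_preim (c_P a) (pr _ _)).
  apply: constructible_and; last exact: c_G.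
  by apply: constructible_preim (pl _ _); apply: constructible_Bset.
have S_uniq a a' y : S a y -> S a' y -> a = a'.
  move=> [z [[B1 _] [_ g]]] [z' [[B1' _] [_ g']]]; apply: val_inj.
  exact: (glue_rel_codim (le_a a) (le_a a') B1 B1' g g').
transitivity (\sum_a chi (S a)).
  rewrite -(chi_exfin chiP c_S S_uniq); apply: chi_ext => y; split.
    case=> By /(unglue By)[a an [y1 [y2 [B1 B2 g]]]].
    have ha : (a < n.+1)%N by [].
    by exists (Ordinal ha), (row_mx y1 y2); rewrite /P /G row_mxKl row_mxKr.
  case=> a [z [_ [By g]]]; split=> //; exact: glue_rel_split g.
apply: eq_bigr => a _.
rewrite -(chi_prod chiP); try exact: constructible_Bset.
symmetry; apply: (@chi_bij F chi chiP _ _ _ _ (fun z y => @Bset F s _ c n y /\ G a z y)) => //.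
- have pl := fun m p => polymx_lsub (@polymx_id F (m + p)).
  have pr := fun m p => polymx_rsub (@polymx_id F (m + p)).
  apply: constructible_and; last exact: c_G.
  by apply: constructible_preim (pr _ _); apply: constructible_Bset.
- move=> z [B1 B2]; have [y By g] := glue_exists (le_a a) B1 B2.
  by exists y => //; exists z.
- by move=> y [z [Pz h]]; exists z.
- move=> z y y' _ _ _ [[_ r _] g] [[_ r' _] g'].
  by apply: (can_inj vec_mxK); apply: glue_rel_uniq r r' g g'.
move=> z z' y [[_ r1 _] [_ r2 _]] [[_ r1' _] [_ r2' _]] _ [_ g] [_ g'].
rewrite -[z]hsubmxK -[z']hsubmxK; congr row_mx; apply: (can_inj vec_mxK).
  by have := glue_rel_uniql (le_a a) r1 r1' g g'.
by have := glue_rel_uniqr (leq_subr a n) r2 r2' g g'.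
Qed.

End Multiplicativity.

(** * Tori acting on the direct sum *)

Section DirectSumWeights.
Variable F : fieldType.
Variables (d1 d2 : nat) (c1 : lie_sc F d1) (c2 : lie_sc F d2).

Definition extend_weight (l : 'I_d1 -> int) (r : 'I_(d1 + d2)) : int :=
  if split r is inl a then l a else 0.

(** Structure constants vanish unless all three indices lie in the same summand, and there the j-th
    and k-th weights coincide. *)
Lemma bracket_scaling_ideal z : 
  bracket_scaling true (lie_dsum c1 c2) (fun r => z ^ extend_weight (fun _ => 1) r).
Proof.
move=> i j k e; rewrite /lie_dsum /extend_weight.
by case: (split i); case: (split j); case: (split k) => *; rewrite ?mulr0 // mul1r.
Qed.

Lemma bracket_scaling_aut l z : z != 0 -> diag_aut c1 l ->
  bracket_scaling false (lie_dsum c1 c2) (fun r => z ^ extend_weight l r).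
Proof.
move=> nz hl i j k e; rewrite /lie_dsum /extend_weight.
case: (split i) => a; case: (split j) => b; case: (split k) => r; rewrite ?mulr0 //.
  by rewrite -expfzDr // hl.
by rewrite expr0z !mul1r.
Qed.

End DirectSumWeights.

Theorem theorem3p3 (R : realType)
  (chi : forall m, ('rV[R[i]]_m -> Prop) -> int)
  (Hchi : is_euler_char chi)
  (d1 d2 : nat) (cL : lie_sc R[i] d1) (cN : lie_sc R[i] d2)
  (HL : is_lie cL) (HN : is_lie cN) :
  (forall n : nat,
     chi _ (B_ideal (lie_dsum cL cN) n) =
     \sum_(a < n.+1) chi _ (B_ideal cL a) * chi _ (B_ideal cN (n - a)%N)) /\
  ((forall j : 'I_d1, exists l : 'I_d1 -> int, l j != 0 /\ diag_aut cL l) ->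
   forall n : nat,
     chi _ (B_le (lie_dsum cL cN) n) =
     \sum_(a < n.+1) chi _ (B_le cL a) * chi _ (B_le cN (n - a)%N)).
Proof.
have chiI d (c : lie_sc R[i] d) n : chi _ (B_ideal c n) = chi _ (@Bset _ true d c n).
  by apply: chi_ext => y; apply: B_idealE.
have chiS d (c : lie_sc R[i] d) n : chi _ (B_le c n) = chi _ (@Bset _ false d c n).
  by apply: chi_ext => y; apply: B_leE.
split=> [n|autL n].
  rewrite chiI (chi_Bset_split Hchi) ?(chi_split_sum Hchi) => [|j].
    by apply: eq_bigr => a _; rewrite !chiI.
  (* For ideals, plain scaling of L serves every basis vector at once. *)
  exists (extend_weight (fun _ => 1)); split=> [|r|z nz].
  - by rewrite /extend_weight split_lshift.
  - by rewrite /extend_weight split_rshift.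
  - exact: bracket_scaling_ideal.
rewrite chiS (chi_Bset_split Hchi) ?(chi_split_sum Hchi) => [|j].
  by apply: eq_bigr => a _; rewrite !chiS.
have [l [lj hl]] := autL j.
(* The automorphisms supplied for j are extended by the identity of N. *)
exists (extend_weight l); split=> [|r|z nz].
- by rewrite /extend_weight split_lshift.
- by rewrite /extend_weight split_rshift.
- exact: bracket_scaling_aut.
Qed.
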